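(* Let $\varepsilon>0$ be an arbitrary fixed constant and let $\mathcal{X}_p$ be as described in the context, with edges given their Euclidean lengths. If $np^2\to\infty$ then with high probability every $(1+\varepsilon)$-spanner for $\mathcal{X}_p$ has $\Omega(\varepsilon^{-1/2}n)$ edges.
   Context: Let $X_1,\dots,X_n$ be $n$ independent uniformly random points of $[0,1]^2$, and let $\mathcal{X}_p$ denote the random graph on these points in which each pair is joined by an edge independently with probability $p=p(n)$; the edge $\{X_i,X_j\}$ has length $|X_i-X_j|$. For a graph $G=(V,E)$ with edge lengths, $d_{v,w}$ denotes the shortest-path distance; a $t$-spanner is a subset $E'\subseteq E$ such that, writing $d'_{v,w}$ for shortest-path distances in $(V,E')$, $d'_{v,w}\le t\,d_{v,w}$ for all $v,w\in V$. ''With high probability'' means with probability tending to 1 as $n\to\infty$. *)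

(* Defs.v *)
From mathcomp Require Import all_boot all_order all_algebra.
From mathcomp Require Import all_classical all_reals all_analysis.

Set Implicit Arguments.
Unset Strict Implicit.
Unset Printing Implicit Defensive.

Import Order.TTheory GRing.Theory Num.Theory.

Local Open Scope classical_set_scope.
Local Open Scope ring_scope.

Section Spanners.
Context {R : realType} {V : finType}.
Implicit Types (E : {set {set V}}) (len : V -> V -> R).

(* A graph on V is given by its edge set, a set of two-element sets. *)
Definition adj E : rel V := fun v w => [set v; w]%SET \in E.

(* [v :: q] lists the vertices of a path of E from v to w, without repetition;
   the case q = [::] is the trivial path from v to itself. *)
Definition is_path E (v w : V) (q : seq V) : Prop :=
  [/\ path (adj E) v q, uniq (v :: q) & last v q = w].

Fixpoint path_length len (v : V) (q : seq V) : R :=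
  if q is u :: q' then len v u + path_length len u q' else 0.

(* The value is +oo when no path joins v to w, since ereal_inf set0 = +oo. *)
Definition graph_dist E len (v w : V) : \bar R :=
  ereal_inf [set (path_length len v q)%:E | q in [set q | is_path E v w q]].

Definition spanner (t : R) E len (E' : {set {set V}}) : Prop :=
  E' \subset E /\
  forall v w, (graph_dist E' len v w <= t%:E * graph_dist E len v w)%E.

End Spanners.

(* The canonical norm of R * R is the sup norm, hence the explicit formula. *)
Definition eucl_dist {R : realType} (x y : R * R) : R :=
  Num.sqrt ((x.1 - y.1) ^+ 2 + (x.2 - y.2) ^+ 2).

Definition mutually_independent d (T : measurableType d) (R : realType)
    (P : probability T R) (I : finType) (F : I -> set (set T)) : Prop :=
  forall (J : {set I}) (A : I -> set T), (forall i, i \in J -> F i (A i)) ->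
    P (\bigcap_(i in [set` J]) A i) = (\prod_(i in J) P (A i))%E.

Definition sigma_of d d' (T : measurableType d) (T' : measurableType d')
    (f : T -> T') : set (set T) :=
  preimage_set_system setT f measurable.

Definition vpair (n : nat) := {e : {set 'I_n} | #|e| == 2%N}.

Section RandomGeometricGraph.
Context {d : measure_display} {T : measurableType d} {R : realType}.
Context {P : probability T R} {n : nat}.
Context (X : 'I_n -> {RV P >-> (R * R)%type}) (Y : vpair n -> {RV P >-> bool}).

Definition uniform_on_square (Z : {RV P >-> (R * R)%type}) : Prop :=
  forall B : set (R * R), measurable B ->
    distribution P Z B =
    (lebesgue_measure \x lebesgue_measure)%E (B `&` (`[0, 1] `*` `[0, 1])).

(* Y e is the indicator that the pair e is joined; the points and the edge
   indicators form a single mutually independent family. *)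
Definition random_geometric_model (p : R) : Prop :=
  [/\ forall i, uniform_on_square (X i),
      forall e, P (Y e @^-1` [set true]) = p%:E &
      mutually_independent P
        (fun k : 'I_n + vpair n => match k with
                                   | inl i => sigma_of (X i)
                                   | inr e => sigma_of (Y e)
                                   end)].

Definition random_edges (w : T) : {set {set 'I_n}} :=
  [set val e | e : vpair n & Y e w]%SET.

Definition random_len (w : T) (i j : 'I_n) : R := eucl_dist (X i w) (X j w).

End RandomGeometricGraph.

(* Main.v *)
Require Import Defs.
From mathcomp Require Import all_boot all_order all_algebra.
From mathcomp Require Import all_classical all_reals all_analysis.
From mathcomp Require Import measurable_realfun.
From mathcomp Require Import ring lra zify.
Import Order.TTheory GRing.Theory Num.Theory.
Import numFieldNormedType.Exports.
Local Open Scope classical_set_scope.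
Local Open Scope ring_scope.

Set Implicit Arguments.
Unset Strict Implicit.
Unset Printing Implicit Defensive.

(** Let (i, j) be an edge of length about r such that no other neighbour u of i
    satisfies |iu| + |uj| <= (1 + 2 eps) |ij|.  Every path from i to j other than
    the edge itself leaves i through such a u, so a (1 + eps)-spanner contains
    the edge.  The points u in question lie in an ellipse of area of order
    eps^(1/2) r^2, hence if n p r^2 is a small multiple of eps^(-1/2), the
    expected number of blocking triples (i, j, u) is at most half the expected
    number of edges of length about r, which is of order eps^(-1/2) n.  Both
    counts are sums of indicators that are independent as soon as their vertex
    sets are disjoint; overlapping pairs are dominated by trees on at most five
    vertices, which makes both variances O(n), and Chebyshev's inequality
    concludes.  For eps >= 1 the same count with every near neighbour blocking
    bounds the number of non-isolated vertices from below, each of which has an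
    incident spanner edge.

    The geometry enters only through the cells of a fine grid on the square, so
    that the probabilistic part takes place in a finite product space. *)

(** * Finite product laws *)

Section ProductLaw.
Context {R : realFieldType} {I V : finType} (m : I -> V -> R).
Implicit Types (f g : {ffun I -> V} -> R) (A : pred I).

Definition weight (z : {ffun I -> V}) : R := \prod_i m i (z i).
Definition mean f : R := \sum_z weight z * f z.
Definition depends A f := forall z z' : {ffun I -> V}, {in A, z =1 z'} -> f z = f z'.

Lemma dependsS A B f : {subset A <= B} -> depends A f -> depends B f.
Proof. by move=> AB fA z z' zz'; apply: fA => k /AB; exact: zz'. Qed.

Lemma dependsM A f g : depends A f -> depends A g ->
  depends A (fun z => f z * g z).
Proof. by move=> fA gA z z' zz'; rewrite (fA z z') ?(gA z z'). Qed.

Lemma depends_coord A k h : k \in A -> depends A (fun z => h (z k)).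
Proof. by move=> kA z z' zz'; rewrite zz'. Qed.

Lemma eq_mean f g : f =1 g -> mean f = mean g.
Proof. by move=> fg; apply: eq_bigr => z _; rewrite fg. Qed.

Lemma mean_sum (J : finType) (Q : pred J) (F : J -> {ffun I -> V} -> R) :
  mean (fun z => \sum_(j | Q j) F j z) = \sum_(j | Q j) mean (F j).
Proof.
by rewrite exchange_big; apply: eq_bigr => z _; rewrite mulr_sumr.
Qed.

Lemma meanZ a f : mean (fun z => a * f z) = a * mean f.
Proof. by rewrite mulr_sumr; apply: eq_bigr => z _; rewrite mulrCA. Qed.

Lemma meanD f g : mean (fun z => f z + g z) = mean f + mean g.
Proof. by rewrite -big_split; apply: eq_bigr => z _; rewrite mulrDr. Qed.

Hypothesis m_ge0 : forall i v, 0 <= m i v.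
Hypothesis m_sum1 : forall i, \sum_v m i v = 1.

Lemma weight_ge0 z : 0 <= weight z.
Proof. by apply: prodr_ge0. Qed.

Lemma weight_sum1 : \sum_z weight z = 1.
Proof.
have /= <- := bigA_distr_bigA (fun i v => m i v).
by rewrite big1.
Qed.

Lemma mean1 : mean (fun=> 1) = 1.
Proof. by rewrite -[RHS]weight_sum1; apply: eq_bigr => z _; rewrite mulr1. Qed.

Lemma le_mean f g : (forall z, f z <= g z) -> mean f <= mean g.
Proof. by move=> fg; apply: ler_sum => z _; rewrite ler_wpM2l ?weight_ge0. Qed.

Lemma mean_ge0 f : (forall z, 0 <= f z) -> 0 <= mean f.
Proof. by move=> f0; apply: sumr_ge0 => z _; rewrite mulr_ge0 ?weight_ge0. Qed.

(** Distributing the product over the sums factors the mean; every coordinate other than [k]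
    contributes its total mass 1. *)
Lemma mean_coord k h : mean (fun z => h (z k)) = \sum_v m k v * h v.
Proof.
pose F i v := if i == k then m k v * h v else m i v.
have /= E := bigA_distr_bigA F.
transitivity (\sum_(z : {ffun I -> V}) \prod_i F i (z i)).
  apply: eq_bigr => z _; rewrite /weight (bigD1 k) //= [RHS](bigD1 k) //=.
  rewrite /F eqxx mulrAC; congr (_ * _).
  by apply: eq_bigr => i /negPf ->.
rewrite -E (bigD1 k) //= [X in _ * X]big1 ?mulr1 /F ?eqxx //.
by move=> i /negPf ->.
Qed.

(* Exchanging the coordinates outside A between two independent copies of z
   preserves the product law. *)
Lemma mean_indep A f g : depends A f -> depends (predC A) g ->
  mean (fun z => f z * g z) = mean f * mean g.
Proof.
move=> fA gA.
pose mix (z z' : {ffun I -> V}) := [ffun k => if A k then z k else z' k].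
pose swap (zz : {ffun I -> V} * {ffun I -> V}) := (mix zz.1 zz.2, mix zz.2 zz.1).
have swapK : involutive swap.
  move=> [z z']; rewrite /swap /mix /=; congr pair; apply/ffunP => k;
  by rewrite !ffunE; case: (A k).
rewrite -[LHS]mulr1 -weight_sum1 /mean !big_distrlr /= !pair_big /=.
rewrite [RHS](reindex_inj (inv_inj swapK)) /=.
apply: eq_bigr => -[z z'] _ /=.
have -> : f (mix z z') = f z.
  by apply: fA => k; rewrite unfold_in /mix ffunE => ->.
have -> : g (mix z' z) = g z.
  by apply: gA => k; rewrite !unfold_in /= /mix ffunE => /negPf ->.
have W : weight z * weight z' = weight (mix z z') * weight (mix z' z).
  rewrite /weight -!big_split; apply: eq_bigr => k _ /=.
  by rewrite /mix !ffunE; case: (A k); rewrite // mulrC.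
by rewrite mulrAC W; ring.
Qed.

Definition variance f := mean (fun z => (f z - mean f) ^+ 2).

Lemma varianceE f : variance f = mean (fun z => f z * f z) - mean f * mean f.
Proof.
rewrite /variance; set e := mean f.
rewrite (@eq_mean _ (fun z => f z * f z + ((- 2 * e) * f z + (e ^+ 2) * 1))); last first.
  by move=> z; ring.
by rewrite !meanD !meanZ mean1 -/e; ring.
Qed.

Lemma chebyshev_fin f t : 0 < t ->
  \sum_(z | t <= `|f z - mean f|) weight z <= variance f / t ^+ 2.
Proof.
move=> t0; rewrite ler_pdivlMr ?exprn_gt0// mulr_suml /variance.
rewrite [leRHS](bigID (fun z => t <= `|f z - mean f|)) /=.
rewrite -[leLHS]addr0 lerD //; last first.
  by apply: sumr_ge0 => z _; rewrite mulr_ge0 ?weight_ge0 ?sqr_ge0.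
apply: ler_sum => z tz; rewrite ler_wpM2l ?weight_ge0//.
by rewrite -[leRHS]real_normK ?num_real// ler_pXn2r ?nnegrE// ltW.
Qed.

(** Pairs that do not meet have covariance 0; for the others the product of the means, being
    nonnegative, is dropped. *)
Lemma variance_sum_le (J : finType) (X : J -> {ffun I -> V} -> R) (meet : rel J) :
  (forall a z, 0 <= X a z) ->
  (forall a b, ~~ meet a b ->
     mean (fun z => X a z * X b z) = mean (X a) * mean (X b)) ->
  variance (fun z => \sum_a X a z) <=
  \sum_a \sum_(b | meet a b) mean (fun z => X a z * X b z).
Proof.
move=> X0 Xind; rewrite varianceE mean_sum.
rewrite (@eq_mean _ (fun z => \sum_a \sum_b X a z * X b z)); last first.
  by move=> z; rewrite big_distrlr.
rewrite mean_sum big_distrlr /= -sumrB; apply: ler_sum => a _.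
rewrite mean_sum -sumrB (bigID (meet a)) /=.
rewrite -[leRHS]addr0 lerD //.
  by apply: ler_sum => b _; rewrite gerBl mulr_ge0 ?mean_ge0.
by rewrite big1 // => b mab; rewrite Xind ?subrr.
Qed.

End ProductLaw.

(** * Counting edges and blocking triples *)

Section EdgeCounts.
Context {R : realFieldType} {n : nat} {V : finType}.
Context (m : 'I_n + vpair n -> V -> R) (on : pred V).
Implicit Types (z : {ffun 'I_n + vpair n -> V}) (s : seq 'I_n).

(** [insub] fails on the singleton arising from [i = j], so no vertex is joined to itself. *)
Definition joined z (i j : 'I_n) : bool :=
  if insub [set i; j]%SET is Some e then on (z (inr e)) else false.

(** The coordinates that determine the subgraph on [s]. Disjoint vertex lists give disjoint sets of
    coordinates, which is the source of all independence below. *)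
Definition inside s : pred ('I_n + vpair n) := fun k =>
  match k with inl i => i \in s | inr e => [forall x in val e, x \in s] end.

Lemma joinedC z i j : joined z i j = joined z j i.
Proof. by rewrite /joined finset.setUC. Qed.

Lemma joined_neq z i j : joined z i j -> i != j.
Proof.
rewrite /joined; case: insubP => //= e + _ _.
by apply: contraTneq => ->; rewrite finset.setUid cards1.
Qed.

Lemma vpair_ex (i j : 'I_n) : i != j ->
  exists2 e : vpair n, val e = [set i; j]%SET &
  forall z, joined z i j = on (z (inr e)).
Proof.
move=> ij; have H : #|[set i; j]%SET| == 2%N by rewrite cards2 ij.
exists (exist (fun e : {set 'I_n} => #|e| == 2%N) _ H) => // z.
by rewrite /joined insubT.
Qed.

Lemma depends_vertex s i (h : V -> R) : i \in s ->
  depends (inside s) (fun z => h (z (inl i))).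
Proof. by move=> si; apply: depends_coord. Qed.

Lemma depends_joined s i j : i \in s -> j \in s ->
  depends (inside s) (fun z => (joined z i j)%:R : R).
Proof.
move=> si sj z z' zz'; rewrite /joined; case: insubP => //= e _ eE.
rewrite zz' // unfold_in /=; apply/forall_inP => x; rewrite eE !inE.
by case/orP => /eqP ->.
Qed.

Lemma insideS s s' : {subset s <= s'} -> {subset inside s <= inside s'}.
Proof.
move=> ss' [i|e]; rewrite !unfold_in /=; first exact: ss'.
by move=> /forall_inP H; apply/forall_inP => x xe; apply/ss'/H.
Qed.

Lemma inside_disjoint s s' : (forall x, x \in s -> x \notin s') ->
  {subset inside s' <= predC (inside s)}.
Proof.
move=> ss' [i|e]; rewrite !unfold_in /=.
  by apply: contraL; apply: ss'.
have /card_gt0P[x xe] : (0 < #|val e|)%N by rewrite (eqP (valP e)).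
move=> /forall_inP H'; apply/negP => /forall_inP H.
by have := ss' _ (H x xe); rewrite H'.
Qed.

Hypothesis m_ge0 : forall k v, 0 <= m k v.
Hypothesis m_sum1 : forall k, \sum_v m k v = 1.
Context (p : R).
Hypothesis m_on : forall e, \sum_v m (inr e) v * (on v)%:R = p.

(** The position of the new vertex [v] and the pair joining it to [v0] are independent of each other
    and of everything inside [s]; the pair contributes [p] and the position is averaged out. *)
Lemma mean_fresh s g (phi : {ffun 'I_n + vpair n -> V} -> V -> R) v0 v :
  depends (inside s) g -> (forall c, depends (inside s) (phi^~ c)) ->
  v0 \in s -> v \notin s ->
  mean m (fun z => g z * phi z (z (inl v)) * (joined z v0 v)%:R) =
  p * mean m (fun z => g z * \sum_c m (inl v) c * phi z c).
Proof.
move=> gs phis v0s vs.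
have [|e eE jE] := @vpair_ex v0 v; first by apply: contraNneq vs => <-.
have vN : inl v \in predC (inside s) by [].
have eN : inr e \in predC (inside s).
  rewrite !unfold_in /=; apply/negP => /forall_inP/(_ v); rewrite eE !inE eqxx orbT.
  by move=> /(_ isT); apply/negP.
(* Splitting by the value [c] of the new position makes each summand a product of functions of
   disjoint coordinates. *)
rewrite (@eq_mean _ _ _ _ _ (fun z => \sum_c (g z * phi z c) *
    ((z (inl v) == c)%:R * (on (z (inr e)))%:R))); last first.
  move=> z; rewrite jE (bigD1 (z (inl v))) //= eqxx mul1r big1 ?addr0 //.
  by move=> c; rewrite eq_sym => /negPf ->; rewrite mul0r mulr0.
rewrite mean_sum [in RHS](@eq_mean _ _ _ _ _
  (fun z => \sum_c m (inl v) c * (g z * phi z c))); last first.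
  by move=> z; rewrite mulr_sumr; apply: eq_bigr => c _; rewrite mulrCA.
rewrite mean_sum mulr_sumr; apply: eq_bigr => c _.
rewrite (@mean_indep _ _ _ m m_sum1 (inside s)); first last.
- apply: dependsM.
    by apply: (@depends_coord _ _ _ _ (inl v) (fun v => (v == c)%:R)).
  by apply: (@depends_coord _ _ _ _ (inr e) (fun v => (on v)%:R)).
- exact: dependsM.
rewrite (@mean_indep _ _ _ m m_sum1 (pred1 (inl v)) (fun z => (z (inl v) == c)%:R)
   (fun z => (on (z (inr e)))%:R)); first last.
- by apply: (@depends_coord _ _ _ _ (inr e) (fun v => (on v)%:R)).
- by apply: (@depends_coord _ _ _ _ (inl v) (fun v => (v == c)%:R)); exact: eqxx.
rewrite (@mean_coord _ _ _ m m_sum1 _ (fun v => (v == c)%:R)).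
rewrite (@mean_coord _ _ _ m m_sum1 _ (fun v => (on v)%:R)) m_on.
rewrite (bigD1 c) //= eqxx mulr1 big1 ?addr0; last first.
  by move=> x /negPf ->; rewrite mulr0.
by rewrite meanZ; ring.
Qed.

(** * Near neighbours and overlapping cherries *)

Context (near : rel V) (q : R).
Hypothesis near_sym : symmetric near.
Hypothesis near_q : forall i c, \sum_v m (inl i) v * (near c v)%:R <= q.

Definition nb i j z : R := (joined z i j && near (z (inl i)) (z (inl j)))%:R.

Lemma nbC i j z : nb i j z = nb j i z.
Proof. by rewrite /nb joinedC near_sym. Qed.

Lemma nb_ge0 i j z : 0 <= nb i j z. Proof. exact: ler0n. Qed.

Lemma nb_le1 i j z : nb i j z <= 1. Proof. by rewrite lern1 leq_b1. Qed.

Lemma depends_nb s i j : i \in s -> j \in s -> depends (inside s) (nb i j).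
Proof.
move=> si sj z z' zz'; rewrite /nb -!mulnb !natrM.
rewrite (@depends_joined s i j si sj z z' zz').
by rewrite !(zz' (inl _)).
Qed.

Hypothesis p_ge0 : 0 <= p.
Hypothesis q_ge0 : 0 <= q.

(** At most [size s] choices of [v] are old vertices, each with factor at most 1; a fresh vertex is
    joined and near to [v0] with probability at most [p * q], whatever happens inside [s]. *)
Lemma mean_grow s g v0 : v0 \in s -> (forall z, 0 <= g z) ->
  depends (inside s) g ->
  \sum_v mean m (fun z => g z * nb v0 v z) <= ((size s)%:R + n%:R * p * q) * mean m g.
Proof.
move=> v0s g0 gs; have mg0 : 0 <= mean m g by exact: mean_ge0.
rewrite (bigID (mem s)) /= mulrDl lerD //.
  rewrite (@le_trans _ _ (\sum_(i in s) mean m g)) //.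
    apply: ler_sum => v _; apply: le_mean => // z.
    by rewrite ler_piMr ?nb_le1.
  rewrite sumr_const -[leLHS]mulr_natl ler_wpM2r // ler_nat; exact: card_size.
rewrite (@le_trans _ _ (\sum_(v : 'I_n) p * q * mean m g)) //; last first.
  by rewrite sumr_const card_ord -[leLHS]mulr_natl !mulrA.
rewrite [leLHS]big_mkcond; apply: ler_sum => v _ /=.
case: ifP => [vs|_]; last by rewrite !mulr_ge0.
rewrite (@eq_mean _ _ _ _ _ (fun z =>
  g z * (near (z (inl v0)) (z (inl v)))%:R * (joined z v0 v)%:R)); last first.
  by move=> z; rewrite /nb -mulnb natrM mulrAC mulrA.
rewrite (@mean_fresh s g (fun z c => (near (z (inl v0)) c)%:R)) //; last first.
  by move=> c; apply: (@depends_vertex s v0 (fun x => (near x c)%:R)).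
rewrite -mulrA ler_wpM2l // mulrC -mulrC -meanZ.
by apply: le_mean => // z; rewrite mulrC ler_wpM2r.
Qed.

(** Two near neighbours of a common centre [a.1.1]. The leaves may coincide, so that a cherry can
    also stand for a single edge. *)
Definition cherry (a : 'I_n * 'I_n * 'I_n) z : R :=
  nb a.1.1 a.1.2 z * nb a.1.1 a.2 z.

Definition cherry_vertices (a : 'I_n * 'I_n * 'I_n) : seq 'I_n :=
  [:: a.1.1; a.1.2; a.2].

Definition meeting (a b : 'I_n * 'I_n * 'I_n) : bool :=
  has (mem (cherry_vertices a)) (cherry_vertices b).

Lemma cherry_ge0 a z : 0 <= cherry a z.
Proof. by rewrite mulr_ge0 ?nb_ge0. Qed.

Lemma depends_cherry a : depends (inside (cherry_vertices a)) (cherry a).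
Proof. by apply: dependsM; apply: depends_nb; rewrite !inE eqxx ?orbT. Qed.

(** Two applications of [mean_grow]: the second new vertex hangs on [v0] or on the first new one.
    The successor on [size s] accounts for the first new vertex. *)
Lemma mean_grow2 s g v0 : v0 \in s -> (forall z, 0 <= g z) ->
  depends (inside s) g ->
  \sum_x \sum_y mean m (fun z => g z * (nb v0 x z * nb v0 y z)) <=
  ((size s).+1%:R + n%:R * p * q) ^+ 2 * mean m g /\
  \sum_x \sum_y mean m (fun z => g z * (nb v0 x z * nb x y z)) <=
  ((size s).+1%:R + n%:R * p * q) ^+ 2 * mean m g.
Proof.
move=> v0s g0 gs; set C := _ + _.
have npq0 : 0 <= n%:R * p * q by rewrite !mulr_ge0.
have C0 : 0 <= C by rewrite addr_ge0.
have gx0 x z : 0 <= g z * nb v0 x z by rewrite mulr_ge0 ?nb_ge0.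
have gxs x : depends (inside (x :: s)) (fun z => g z * nb v0 x z).
  apply: dependsM; last by apply: depends_nb; rewrite inE ?eqxx ?v0s ?orbT.
  by apply: dependsS gs; apply: insideS => i si; rewrite inE si orbT.
(* [w x] is the vertex to which the second new vertex is attached. *)
have step w : (forall x, w x \in x :: s) ->
    \sum_x \sum_y mean m (fun z => g z * (nb v0 x z * nb (w x) y z)) <=
    C ^+ 2 * mean m g.
  move=> ws; rewrite (@le_trans _ _ (\sum_x C * mean m (fun z => g z * nb v0 x z)))//.
    apply: ler_sum => x _.
    rewrite (le_trans _ (mean_grow (ws x) (gx0 x) (gxs x)))//.
    by apply: ler_sum => y _; apply: le_mean => // z; rewrite mulrA.
  rewrite -mulr_sumr expr2 -mulrA ler_wpM2l //.
  rewrite (le_trans (mean_grow v0s g0 gs))// ler_wpM2r ?mean_ge0//.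
  by rewrite lerD2r ler_nat.
by split; [apply: (step (fun=> v0)) | apply: (step id)] => x;
  rewrite inE ?v0s ?eqxx ?orbT.
Qed.

Lemma sum3 (F : 'I_n * 'I_n * 'I_n -> R) :
  \sum_a F a = \sum_i \sum_j \sum_u F (i, j, u).
Proof. by rewrite !pair_bigA; apply: eq_bigr => -[[]]. Qed.

(** The vertex [v] is the centre or one of the two leaves; seen from a leaf, a cherry is a path of
    two edges, whence the factor 2. *)
Lemma sum_cherry_through g v :
  (forall z, 0 <= g z) ->
  \sum_(b | v \in cherry_vertices b) mean m (fun z => g z * cherry b z) <=
  \sum_x \sum_y mean m (fun z => g z * (nb v x z * nb v y z)) +
  2 * \sum_x \sum_y mean m (fun z => g z * (nb v x z * nb x y z)).
Proof.
move=> g0; set F := fun b => mean m (fun z => g z * cherry b z).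
have F0 b : 0 <= F b by apply: mean_ge0 => // z; rewrite mulr_ge0 ?cherry_ge0.
rewrite (@le_trans _ _ (\sum_b (((b.1.1 == v)%:R + (b.1.2 == v)%:R +
    (b.2 == v)%:R) * F b)))//.
  rewrite big_mkcond; apply: ler_sum => b _.
  rewrite !inE ![v == _]eq_sym; case: ifP => // H; last first.
    by rewrite mulr_ge0 // !addr_ge0.
  rewrite -/(F b) ler_peMl // -!natrD ler1n addn_gt0 addn_gt0 !lt0b -orbA; exact: H.
rewrite (eq_bigr (fun b => (b.1.1 == v)%:R * F b + (b.1.2 == v)%:R * F b +
    (b.2 == v)%:R * F b)); last by move=> b _; rewrite !mulrDl.
rewrite !big_split /= mulr_natl mulr2n addrA !sum3 /=.
have delta (G : 'I_n -> R) : \sum_i (i == v)%:R * G i = G v.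
  rewrite (bigD1 v) //= eqxx mul1r big1 ?addr0 // => i /negPf ->.
  by rewrite mul0r.
rewrite !lerD //.
- rewrite (eq_bigr (fun i => (i == v)%:R * \sum_j \sum_u F (i, j, u))).
    by rewrite delta.
  by move=> i _; rewrite mulr_sumr; apply: eq_bigr => j _; rewrite mulr_sumr.
- apply: ler_sum => i _.
  rewrite (eq_bigr (fun j => (j == v)%:R * \sum_u F (i, j, u))).
    rewrite delta; apply: ler_sum => u _; apply: le_mean => // z.
    by rewrite /cherry /= nbC.
  by move=> j _; rewrite mulr_sumr.
- apply: ler_sum => i _; apply: ler_sum => j _; rewrite delta.
  by apply: le_mean => // z; rewrite /cherry /= [nb i v z]nbC [X in g z * X]mulrC.
Qed.

(** A cherry meeting [a] passes through one of the three vertices of [a], and each of these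
    contributes at most three growth factors [C ^+ 2]. The remaining sum over [a] is grown from a
    single vertex. The 4 is one more than the number of vertices of [a]. *)
Lemma overlap_bound :
  \sum_a \sum_(b | meeting a b) mean m (fun z => cherry a z * cherry b z) <=
  9 * (4 + n%:R * p * q) ^+ 4 * n%:R.
Proof.
set C := 4 + _.
have npq0 : 0 <= n%:R * p * q by rewrite !mulr_ge0.
have C0 : 0 <= C by rewrite addr_ge0.
have E0 a : 0 <= mean m (cherry a) by apply: mean_ge0 => // z; exact: cherry_ge0.
rewrite (@le_trans _ _ (\sum_a (9 * C ^+ 2 * mean m (cherry a))))//.
  apply: ler_sum => a _.
  pose Q v := \sum_(b | v \in cherry_vertices b)
    mean m (fun z => cherry a z * cherry b z).
  have Q_le v : v \in cherry_vertices a -> Q v <= 3 * C ^+ 2 * mean m (cherry a).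
    move=> va; apply: (le_trans (sum_cherry_through _ (cherry_ge0 a))).
    have [] := mean_grow2 va (cherry_ge0 a) (@depends_cherry a).
    rewrite -/C; lra.
  rewrite (@le_trans _ _ (Q a.1.1 + Q a.1.2 + Q a.2))//; last first.
    have := Q_le a.1.1; have := Q_le a.1.2; have := Q_le a.2.
    rewrite !inE !eqxx !orbT => /(_ isT) H1 /(_ isT) H2 /(_ isT) H3; lra.
  rewrite /Q !(big_mkcond (fun b => _ \in cherry_vertices b)).
  rewrite [leLHS]big_mkcond.
  rewrite -!big_split; apply: ler_sum => b _ /=.
  have Eb : 0 <= mean m (fun z => cherry a z * cherry b z).
    by apply: mean_ge0 => // z; rewrite mulr_ge0 ?cherry_ge0.
  case: ifP => [/hasP[x xb xa]|_]; last by case: ifP; case: ifP; case: ifP; lra.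
  have /or3P[] : [|| x == a.1.1, x == a.1.2 | x == a.2] by rewrite !inE in xa.
  - by move=> /eqP <-; rewrite xb; do 2 case: ifP; lra.
  - by move=> /eqP <-; rewrite xb; do 2 case: ifP; lra.
  - by move=> /eqP <-; rewrite xb; do 2 case: ifP; lra.
have -> : C ^+ 4 = C ^+ 2 * C ^+ 2 by rewrite -exprD.
rewrite -mulr_sumr sum3 -!(mulrA 9) ler_wpM2l //.
rewrite -[leRHS]mulrA ler_wpM2l ?exprn_ge0 //.
rewrite (@le_trans _ _ (\sum_(i : 'I_n) C ^+ 2))//; last first.
  by rewrite sumr_const card_ord -[leLHS]mulr_natr.
apply: ler_sum => i _.
(* Growing from the list [[:: i]] with weight 1 gives the base [2 + n%:R * p * q], which is at most
   [C]. *)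
pose g (_ : {ffun 'I_n + vpair n -> V}) : R := 1.
have [||+ _] := @mean_grow2 _ g _ (mem_head i [::]); [by []|by []|].
rewrite mean1 // mulr1 => H.
apply: (@le_trans _ _ ((2 + n%:R * p * q) ^+ 2)).
  apply: le_trans H; apply: ler_sum => x _; apply: ler_sum => y _.
  by apply: le_mean => // z; rewrite mul1r.
rewrite ler_pXn2r ?nnegrE ?addr_ge0 // lerD2r ler_nat //.
Qed.

(** Triples without a common vertex use disjoint coordinates, so only overlapping ones enter the
    variance, and their products are dominated by products of cherries. *)
Lemma variance_cherry_le (X : 'I_n * 'I_n * 'I_n -> {ffun _ -> V} -> R) :
  (forall a z, 0 <= X a z <= cherry a z) ->
  (forall a, depends (inside (cherry_vertices a)) (X a)) ->
  variance m (fun z => \sum_a X a z) <= 9 * (4 + n%:R * p * q) ^+ 4 * n%:R.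
Proof.
move=> X_bnd X_dep.
have X0 a z : 0 <= X a z by case/andP: (X_bnd a z).
have Xc a z : X a z <= cherry a z by case/andP: (X_bnd a z).
apply: le_trans overlap_bound.
apply: (le_trans (variance_sum_le (meet := meeting) m_ge0 m_sum1 X0 _)).
  move=> a b /hasPn ab; apply: (mean_indep m_sum1 (X_dep a)).
  apply: dependsS (X_dep b); apply: inside_disjoint => x xa.
  by apply/negP => /ab/negP; apply.
apply: ler_sum => a _; apply: ler_sum => b _; apply: le_mean => // z.
exact: ler_pM.
Qed.

(** * Links and the neighbours that block them *)

Context (ell : rel V) (obs : V -> V -> V -> bool) (omega : R).
Hypothesis ell_near : forall c c', ell c c' -> near c c'.
Hypothesis obs_near : forall c c' u, obs c c' u -> near c u.
Hypothesis obs_omega : forall k c c', ell c c' ->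
  \sum_u m (inl k) u * (obs c c' u)%:R <= omega.

Definition link i j z : R := (joined z i j && ell (z (inl i)) (z (inl j)))%:R.

Definition block i j u z : R :=
  (joined z i u && obs (z (inl i)) (z (inl j)) (z (inl u)))%:R.

Definition links z : R := \sum_i \sum_j link i j z.

Definition blocked z : R :=
  \sum_i \sum_j \sum_(u | u != j) link i j z * block i j u z.

Lemma link_ge0 i j z : 0 <= link i j z. Proof. exact: ler0n. Qed.
Lemma block_ge0 i j u z : 0 <= block i j u z. Proof. exact: ler0n. Qed.

Lemma depends_link s i j : i \in s -> j \in s -> depends (inside s) (link i j).
Proof.
move=> si sj z z' zz'; rewrite /link -!mulnb !natrM.
by rewrite (@depends_joined s i j si sj z z' zz') !(zz' (inl _)).
Qed.

Lemma depends_block s i j u : i \in s -> j \in s -> u \in s ->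
  depends (inside s) (block i j u).
Proof.
move=> si sj su z z' zz'; rewrite /block -!mulnb !natrM.
by rewrite (@depends_joined s i u si su z z' zz') !(zz' (inl _)).
Qed.

Lemma link_le_nb i j z : link i j z <= nb i j z.
Proof.
rewrite /link /nb ler_nat; case: joined => //=.
by case: (ell _ _) (@ell_near (z (inl i)) (z (inl j))) => // ->.
Qed.

Lemma link_idem i j z : link i j z * link i j z = link i j z.
Proof. by rewrite /link; case: andP; rewrite ?mulr1 ?mulr0. Qed.

Lemma block_le_nb i j u z : block i j u z <= nb i u z.
Proof.
rewrite /block /nb ler_nat; case: joined => //=.
by case: (obs _ _ _) (@obs_near (z (inl i)) (z (inl j)) (z (inl u))) => // ->.
Qed.

(** Single links are placed on the triples with [u = j], the form to which [variance_cherry_le]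
    applies. *)
Lemma linksE z :
  links z = \sum_a (a.2 == a.1.2)%:R * link a.1.1 a.1.2 z.
Proof.
rewrite sum3; apply: eq_bigr => i _; apply: eq_bigr => j _ /=.
by rewrite (bigD1 j) //= eqxx mul1r big1 ?addr0 // => u /negPf ->; rewrite mul0r.
Qed.

Lemma blockedE z : blocked z =
  \sum_a (a.2 != a.1.2)%:R * (link a.1.1 a.1.2 z * block a.1.1 a.1.2 a.2 z).
Proof.
rewrite sum3; apply: eq_bigr => i _; apply: eq_bigr => j _ /=.
rewrite big_mkcond; apply: eq_bigr => u _.
by case: (u == j); rewrite ?mul0r ?mul1r.
Qed.

Lemma variance_links : variance m links <= 9 * (4 + n%:R * p * q) ^+ 4 * n%:R.
Proof.
rewrite (funext linksE).
apply: (@variance_cherry_le (fun a z =>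
  (a.2 == a.1.2)%:R * link a.1.1 a.1.2 z)) => [[[i j] u] z|[[i j] u]] /=.
  rewrite mulr_ge0 ?link_ge0 //=; case: eqP => [->|_].
    (* An indicator equals its square, so a link is bounded by the cherry with both leaves at
       [j]. *)
    by rewrite mul1r -link_idem /cherry ler_pM ?link_ge0 ?link_le_nb.
  by rewrite mul0r cherry_ge0.
by apply: dependsM => //; apply: depends_link; rewrite !inE eqxx ?orbT.
Qed.

Lemma variance_blocked :
  variance m blocked <= 9 * (4 + n%:R * p * q) ^+ 4 * n%:R.
Proof.
rewrite (funext blockedE).
apply: (@variance_cherry_le (fun a z => (a.2 != a.1.2)%:R *
  (link a.1.1 a.1.2 z * block a.1.1 a.1.2 a.2 z))) => [[[i j] u] z|[[i j] u]] /=.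
  rewrite !mulr_ge0 ?link_ge0 ?block_ge0 //=; case: eqP => [_|_].
    by rewrite mul0r cherry_ge0.
  by rewrite mul1r /cherry ler_pM ?link_ge0 ?block_ge0 ?link_le_nb ?block_le_nb.
apply: dependsM => //; apply: dependsM.
  by apply: depends_link; rewrite !inE eqxx ?orbT.
by apply: depends_block; rewrite !inE eqxx ?orbT.
Qed.

Lemma mean_link i j : i != j ->
  mean m (link i j) =
  p * \sum_c m (inl i) c * \sum_c' m (inl j) c' * (ell c c')%:R.
Proof.
move=> ij; pose g (_ : {ffun 'I_n + vpair n -> V}) : R := 1.
pose phi (z : {ffun 'I_n + vpair n -> V}) c : R := (ell (z (inl i)) c)%:R.
have phis c : depends (inside [:: i]) (phi^~ c).
  by apply: (@depends_vertex _ i (fun x => (ell x c)%:R)); rewrite inE.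
have jN : j \notin [:: i] by rewrite inE eq_sym.
have gs : depends (inside [:: i]) g by [].
have := mean_fresh gs phis (mem_head i [::]) jN.
rewrite (@eq_mean _ _ _ _ _ (link i j)); last first.
  by move=> z; rewrite /g mul1r /link -mulnb natrM mulrC.
move=> ->; congr (_ * _); rewrite -(mean_coord m_sum1 (inl i)).
by apply: eq_mean => z; rewrite mul1r.
Qed.

Lemma mean_link_block i j u : u != j ->
  mean m (fun z => link i j z * block i j u z) <= p * omega * mean m (link i j).
Proof.
(* A pair in relation [ell] forces [0 <= omega], which then bounds a sum of nonnegative terms. If
   [i] and [j] are never in this relation, both means vanish. *)
move=> uj; have omega0 c c' : ell c c' -> 0 <= omega.
  by move=> /(obs_omega i); apply: le_trans; apply: sumr_ge0 => v _; rewrite mulr_ge0.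
have [[z0 z0P]|none] := pselect (exists z, ell (z (inl i)) (z (inl j))); last first.
  have link0 z : link i j z = 0.
    by rewrite /link; case: andP => // -[_ e]; case: none; exists z.
  rewrite (@eq_mean _ _ _ _ _ (fun=> 0)); last by move=> z; rewrite link0 mul0r.
  rewrite (@eq_mean _ _ _ _ (link i j) (fun=> 0)) //.
  by rewrite /mean big1 ?mulr0 // => z _; rewrite mulr0.
have {omega0}omega0 := omega0 _ _ z0P.
have rhs0 : 0 <= p * omega * mean m (link i j).
  by rewrite !mulr_ge0 // mean_ge0 // => z; apply: link_ge0.
have [ui|ui] := eqVneq u i.
  rewrite (@eq_mean _ _ _ _ _ (fun=> 0)).
    by rewrite {1}/mean big1 // => z _; rewrite mulr0.
  move=> z; rewrite /block ui; case: (boolP (joined z i i)) => [/joined_neq|_].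
    by rewrite eqxx.
  by rewrite mulr0.
pose phi (z : {ffun 'I_n + vpair n -> V}) c : R :=
  (obs (z (inl i)) (z (inl j)) c)%:R.
have phis c : depends (inside [:: i; j]) (phi^~ c).
  by move=> z z' zz'; rewrite /phi !zz' // unfold_in /= !inE eqxx ?orbT.
have uN : u \notin [:: i; j] by rewrite !inE negb_or ui.
have is_ : i \in [:: i; j] by rewrite inE eqxx.
have gs : depends (inside [:: i; j]) (link i j).
  by apply: depends_link; rewrite !inE eqxx ?orbT.
rewrite (@eq_mean _ _ _ _ _
    (fun z => link i j z * phi z (z (inl u)) * (joined z i u)%:R)); last first.
  by move=> z; rewrite /block -mulnb natrM -mulrA [_ * phi _ _]mulrC.
rewrite (mean_fresh gs phis is_ uN) -mulrA ler_wpM2l // -meanZ.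
apply: le_mean => // z; rewrite mulrC /link.
by case: andP => [[_ e]|_]; rewrite ?mulr1 ?mulr0 // obs_omega.
Qed.

Lemma mean_links_ge (a : R) : (forall i j, i != j ->
    a <= \sum_c m (inl i) c * \sum_c' m (inl j) c' * (ell c c')%:R) ->
  n%:R * n.-1%:R * (p * a) <= mean m links.
Proof.
move=> a_le; rewrite mean_sum.
rewrite (@le_trans _ _ (\sum_(i : 'I_n) n.-1%:R * (p * a))) //.
  by rewrite sumr_const card_ord -[leRHS]mulr_natl -mulrA.
apply: ler_sum => i _; rewrite mean_sum (bigD1 i) //=.
rewrite -[leLHS]add0r lerD //.
  by rewrite mean_ge0 // => z; apply: link_ge0.
rewrite (@le_trans _ _ (\sum_(j | j != i) p * a)) //.
  rewrite sumr_const -[leRHS]mulr_natl cardC1 card_ord //.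
by apply: ler_sum => j ji; rewrite mean_link 1?eq_sym // ler_wpM2l // a_le // eq_sym.
Qed.

Lemma mean_blocked_le : 0 <= omega ->
  mean m blocked <= n%:R * p * omega * mean m links.
Proof.
move=> omega0; rewrite !mean_sum mulr_sumr; apply: ler_sum => i _.
rewrite !mean_sum mulr_sumr; apply: ler_sum => j _; rewrite mean_sum.
have mL : 0 <= mean m (link i j) by rewrite mean_ge0 // => z; apply: link_ge0.
rewrite (@le_trans _ _ (\sum_(u : 'I_n) p * omega * mean m (link i j))) //.
  rewrite big_mkcond; apply: ler_sum => u _; case: ifP => [|_].
    exact: mean_link_block.
  by rewrite !mulr_ge0.
by rewrite sumr_const card_ord -[leLHS]mulr_natl !mulrA.
Qed.

(** The mean of [blocked] is at most half the mean [e] of [links]. If both counts are within [e / 8]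
    of their means, their difference exceeds [7e/8 - 5e/8 = e/4]; Chebyshev bounds each of the two
    exceptional events. *)
Lemma links_blocked_dev : 0 <= omega -> n%:R * p * omega <= 2^-1 ->
  0 < mean m links ->
  \sum_(z | links z - blocked z < mean m links / 4) weight m z <=
  2 * (9 * (4 + n%:R * p * q) ^+ 4 * n%:R) / (mean m links / 8) ^+ 2.
Proof.
move=> omega0 small mL; set e := mean m links in mL *; set v := 9 * _ * _.
have e8 : 0 < e / 8 by rewrite divr_gt0.
have mB : mean m blocked <= e / 2.
  apply: (le_trans (mean_blocked_le omega0)); rewrite -/e mulrC.
  by rewrite ler_wpM2l // ltW.
rewrite (@le_trans _ _ (\sum_(z | e / 8 <= `|links z - e|) weight m z +
    \sum_(z | e / 8 <= `|blocked z - mean m blocked|) weight m z)) //.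
  rewrite !(big_mkcond (fun z => _ <= `|_|)) [leLHS]big_mkcond -big_split.
  apply: ler_sum => z _ /=; have W := weight_ge0 m_ge0 z.
  case: ifP => [lt|_]; last by do 2 case: ifP; lra.
  case: ifP => [_|]; first by case: ifP; lra.
  case: ifP => [_|]; first lra.
  move=> /negbT; rewrite -ltNge => + /negbT; rewrite -ltNge.
  rewrite !ltr_norml => /andP[_ hb] /andP[hl _].
  by exfalso; move: lt hb hl mB; lra.
rewrite -mulrA mulr_natl mulr2n lerD //.
  apply: (le_trans (@chebyshev_fin _ _ _ m m_ge0 links _ e8)).
  by rewrite ler_wpM2r ?invr_ge0 ?exprn_ge0 ?variance_links // ltW.
apply: (le_trans (@chebyshev_fin _ _ _ m m_ge0 blocked _ e8)).
by rewrite ler_wpM2r ?invr_ge0 ?exprn_ge0 ?variance_blocked // ltW.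
Qed.

Definition good z i j : bool :=
  [&& joined z i j, ell (z (inl i)) (z (inl j)) &
   [forall u, (u != j) ==>
      ~~ (joined z i u && obs (z (inl i)) (z (inl j)) (z (inl u)))]].

(** A link that is not good has at least one blocking neighbour, so its net contribution is at most
    0; a good one contributes at most 1. *)
Lemma links_blocked_le z : links z - blocked z <=
  #|[set a : 'I_n * 'I_n | good z a.1 a.2]%SET|%:R.
Proof.
rewrite -sum1_card natr_sum big_mkcond /links /blocked -sumrB.
rewrite (eq_bigr _ (fun i _ => esym (sumrB _ _ _ _))) pair_bigA /=.
apply: ler_sum => -[i j] _ /=.
rewrite inE /= /good -mulr_sumr.
have B0 : 0 <= \sum_(u | u != j) block i j u z.
  by apply: sumr_ge0 => u _; exact: block_ge0.
rewrite /link; case: joined => /=; last by rewrite mul0r subr0.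
case: (ell _ _) => /=; last by rewrite mul0r subr0.
rewrite mul1r; case: ifPn => [_|/forallPn[u]]; first by rewrite gerBl.
rewrite negb_imply negbK => /andP[uj bu].
rewrite (bigD1 u uj) /= {1}/block bu /= opprD addrA subrr add0r oppr_le0.
by apply: sumr_ge0 => v _; exact: block_ge0.
Qed.

End EdgeCounts.

(** * From the random graph to a finite product law *)

Section FiniteLaw.
Context {d : measure_display} {T : measurableType d} {R : realType}.
Context (P : probability T R).

Lemma measure_fibers (W : finType) (f : T -> W) (G : pred W) :
  (forall x, measurable (f @^-1` [set x])) ->
  measurable [set w | G (f w)] /\
  P [set w | G (f w)] = (\sum_(x | G x) P (f @^-1` [set x]))%E.
Proof.
move=> mf.
have -> : [set w | G (f w)] = \bigcup_(x in [set` G]) (f @^-1` [set x]).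
  apply/seteqP; split => [w Gw|w [x Gx fw]]; first by exists (f w).
  by rewrite /= (_ : f w = x).
split; first by apply: fin_bigcup_measurable => // x _; exact: mf.
rewrite measure_fin_bigcup //; last first.
  apply/trivIsetP => x y _ _ /eqP xy; apply/seteqP; split => // w [/= wx wy].
  by case: xy; rewrite -wx.
by rewrite -(@bigfs _ _ _ _ (index_enum W)) ?index_enum_uniq // => x _; rewrite mem_index_enum.
Qed.

Context (I V : finType) (Z : I -> T -> V).

Definition law k v : R := fine (P (Z k @^-1` [set v])).

Lemma law_ge0 k v : 0 <= law k v.
Proof. by rewrite fine_ge0. Qed.

Hypothesis mZ : forall k v, measurable (Z k @^-1` [set v]).

Lemma law_fin k v : P (Z k @^-1` [set v]) = (law k v)%:E.
Proof. by rewrite fineK // fin_num_measure. Qed.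

Lemma law_sum k (G : pred V) :
  P [set w | G (Z k w)] = (\sum_v law k v * (G v)%:R)%:E.
Proof.
have [_ ->] := measure_fibers G (mZ k).
under eq_bigr do rewrite law_fin.
rewrite sumEFin big_mkcond; congr (_%:E); apply: eq_bigr => v _.
by case: (G v); rewrite ?mulr1 ?mulr0.
Qed.

Lemma law_sum1 k : \sum_v law k v = 1.
Proof.
apply: (@EFin_inj R); rewrite -(probability_setT P).
have := law_sum k predT; rewrite (_ : [set w | _] = setT); last exact/seteqP.
by move=> ->; under [in RHS]eq_bigr do rewrite mulr1.
Qed.

Lemma joint_fiber (z : {ffun I -> V}) :
  (fun w => [ffun k => Z k w]) @^-1` [set z] =
  \bigcap_(k in [set` [set: I]%SET]) (Z k @^-1` [set z k]).
Proof.
apply/seteqP; split => [w <- k _|w H]; first by rewrite /= ffunE.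
by apply/ffunP => k; rewrite ffunE H //= inE.
Qed.

Lemma measurable_joint_fiber (z : {ffun I -> V}) :
  measurable ((fun w => [ffun k => Z k w]) @^-1` [set z]).
Proof. by rewrite joint_fiber; apply: fin_bigcap_measurable => // k _. Qed.

(** Each fibre of the joint map is an intersection of one event per coordinate, and independence
    turns its probability into a product. *)
Lemma finite_law (F : I -> set (set T)) (G : pred {ffun I -> V}) :
  mutually_independent P F ->
  (forall k v, F k (Z k @^-1` [set v])) ->
  measurable [set w | G [ffun k => Z k w]] /\
  P [set w | G [ffun k => Z k w]] = (\sum_(z | G z) weight law z)%:E.
Proof.
move=> indep FZ.
have [mG ->] := measure_fibers G measurable_joint_fiber; split => //.
rewrite -sumEFin; apply: eq_bigr => z _.
rewrite joint_fiber indep // /weight -prodEFin; apply: eq_big => [k|k _].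
  by rewrite inE.
exact: law_fin.
Qed.

End FiniteLaw.

(** * The grid of half-open cells on the unit square *)

Section Cells.
Context {R : realType} (K : nat).

Definition in_cell (c : 'I_K * 'I_K) (x : R * R) : bool :=
  [&& c.1%:R / K%:R <= x.1, x.1 < c.1.+1%:R / K%:R,
      c.2%:R / K%:R <= x.2 & x.2 < c.2.+1%:R / K%:R].

(** Half-open cells miss the right and upper sides of the square, hence the [option]; [law_outside]
    shows that [None] has probability 0. *)
Definition cell_of (x : R * R) : option ('I_K * 'I_K) := [pick c | in_cell c x].

Definition cell c : set (R * R) := [set x | in_cell c x].

Lemma cellE c : cell c =
  [set` `[c.1%:R / K%:R, c.1.+1%:R / K%:R[%R] `*`
  [set` `[c.2%:R / K%:R, c.2.+1%:R / K%:R[%R].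
Proof.
apply/seteqP; split => x /=; rewrite !in_itv /=.
  by case/and4P => -> -> -> ->.
by case=> /andP[h1 h2] /andP[h3 h4]; apply/and4P.
Qed.

Lemma measurable_cell c : measurable (cell c).
Proof. by rewrite cellE; apply: measurableX. Qed.

Lemma cell_ofP x c : cell_of x = Some c -> in_cell c x.
Proof. by rewrite /cell_of; case: pickP => // c' + [<-]. Qed.

Lemma cell_ofE x c : in_cell c x -> cell_of x = Some c.
Proof.
have uniq1 (a b : 'I_K) (y : R) : (a%:R / K%:R <= y) -> (y < a.+1%:R / K%:R) ->
    (b%:R / K%:R <= y) -> (y < b.+1%:R / K%:R) -> (a <= b)%N.
  have K0 : 0 < K%:R :> R by rewrite ltr0n (leq_ltn_trans _ (ltn_ord a)).
  rewrite !ler_pdivrMr // !ltr_pdivlMr // => h1 _ _ h2.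
  by have := le_lt_trans h1 h2; rewrite ltr_nat ltnS.
rewrite /cell_of; case: pickP => [c' /and4P[h1 h2 h3 h4]|->//].
case/and4P => g1 g2 g3 g4; congr Some.
case: c c' h1 h2 h3 h4 g1 g2 g3 g4 => [a b] [a' b'] /= h1 h2 h3 h4 g1 g2 g3 g4.
congr pair; apply/val_inj/eqP; rewrite /= eqn_leq.
  by rewrite !(@uniq1 _ _ x.1).
by rewrite !(@uniq1 _ _ x.2).
Qed.

Lemma measurable_cell_of v : measurable (cell_of @^-1` [set v]).
Proof.
case: v => [c|].
  rewrite (_ : _ @^-1` _ = cell c); first exact: measurable_cell.
  by apply/seteqP; split => x /=; [exact: cell_ofP | exact: cell_ofE].
rewrite (_ : _ @^-1` _ = ~` \bigcup_(c in setT) cell c).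
  apply: measurableC; apply: fin_bigcup_measurable => // c _.
  exact: measurable_cell.
apply/seteqP; split => x /=.
  by move=> xN [c _ /cell_ofE]; rewrite xN.
by move=> H; case E: (cell_of x) => [c|] //; case: H; exists c => //; exact: cell_ofP.
Qed.

Lemma unif_cell d (T : measurableType d) (P : probability T R)
    (X : {RV P >-> (R * R)%type}) c : uniform_on_square X ->
  P ((cell_of \o X) @^-1` [set Some c]) = ((K%:R ^+ 2)^-1)%:E.
Proof.
move=> Xu.
have K0 : 0 < K%:R :> R by rewrite ltr0n (leq_ltn_trans _ (ltn_ord c.1)).
transitivity (distribution P X (cell c)).
  rewrite /distribution /pushforward; congr (P _).
  by apply/seteqP; split => w /=; [exact: cell_ofP | exact: cell_ofE].
have itvE (a : 'I_K) : lebesgue_measure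
   [set` `[a%:R / K%:R, a.+1%:R / K%:R[%R] = (K%:R^-1 : R)%:E.
  rewrite lebesgue_measure_itv /= lte_fin ltr_pM2r ?invr_gt0 // ltr_nat ltnSn.
  by rewrite -EFinB -mulrBl -natrB // subSnn mul1r.
rewrite Xu; last exact: measurable_cell.
rewrite (_ : cell c `&` _ = cell c).
  rewrite cellE product_measure1E //.
  transitivity ((K%:R^-1 : R)%:E * (K%:R^-1 : R)%:E)%E.
    by congr (_ * _)%E; exact: itvE.
  rewrite -EFinM.
  by congr (_%:E); rewrite expr2 invfM.
apply/setIidPl; rewrite cellE => x /= []; rewrite !in_itv /=.
have le1 (a : 'I_K) : a.+1%:R / K%:R <= 1 :> R.
  by rewrite ler_pdivrMr // mul1r ler_nat.
have ge0 (a : 'I_K) : 0 <= a%:R / K%:R :> R by rewrite divr_ge0.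
move=> /andP[h1 h2] /andP[h3 h4].
split; apply/andP; split.
- exact: le_trans h1.
- exact: le_trans (ltW h2) (le1 _).
- exact: le_trans h3.
- exact: le_trans (ltW h4) (le1 _).
Qed.

End Cells.

(** * Counting in the grid *)

Section Counting.
Context {R : realFieldType}.

(** The set lies between its least element [i] and its greatest element [j], among [j - i + 1]
    integers. *)
Lemma card_interval_le K (Q : pred 'I_K) (w : R) : 0 <= w ->
  (forall i j, Q i -> Q j -> j%:R - i%:R <= w) -> #|Q|%:R <= w + 1.
Proof.
move=> w0 Qw; have [->|] := posnP #|Q|; first by rewrite addr_ge0.
move=> /card_gt0P[k0 Qk0].
case: (arg_minnP (P := Q) val Qk0) => i Qi imin.
case: (arg_maxnP (P := Q) val Qk0) => j Qj jmax.
rewrite (@le_trans _ R (j - i).+1%:R) //; last first.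
  rewrite -natr1 lerD2r natrB ?imin //; exact: Qw.
rewrite ler_nat -(size_iota i (j - i).+1) cardE -(size_map val).
apply: uniq_leq_size; first by rewrite map_inj_uniq ?enum_uniq //; exact: val_inj.
move=> x /mapP[k]; rewrite mem_enum => Qk ->; rewrite mem_iota.
have := imin _ Qk; have := jmax _ Qk; rewrite /= => ? ?; apply/andP; split => //; lia.
Qed.

Lemma card_pairs_le (C D : finType) (Q : pred (C * D)) (A : pred C) (b : R) :
  (forall c, Q c -> A c.1) -> (forall x, #|[pred y | Q (x, y)]|%:R <= b) ->
  #|Q|%:R <= #|A|%:R * b.
Proof.
move=> QA Qb.
have -> : #|Q|%:R = \sum_(p | A p.1 && Q (p.1, p.2)) 1 :> R.
  rewrite -sum1_card natr_sum; apply: eq_bigl => -[x y]; rewrite unfold_in /= andbC.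
  by case: (boolP (Q (x, y))) => //= /QA ->.
rewrite -(pair_big_dep A (fun x y => Q (x, y)) (fun _ _ => 1)) /=.
rewrite -sum1_card natr_sum mulr_suml; apply: ler_sum => x _.
by rewrite mul1r; apply: le_trans (Qb x); rewrite -sum1_card natr_sum.
Qed.

End Counting.

(** * Near cells, link displacements and obstacles, in units of the cell width *)

Section Grid.
Context {R : realType} (h s : nat) (eta eps : R).
Let C : finType := ('I_(2 * h) * 'I_(2 * h))%type.
Implicit Types c u : C.

Definition dx c u : R := u.1%:R - c.1%:R.
Definition dy c u : R := u.2%:R - c.2%:R.

(** [s] is the scale of a link in cell widths. The radius [12 * s] is the one that [detour_real]
    yields for detour vertices when [eps < 1]. *)
Definition grid_near : rel C := fun c u =>
  (`|dx c u| <= 12 * s%:R) && (`|dy c u| <= 12 * s%:R).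

Definition low_quadrant : pred C := fun c => (c.1 < h)%N && (c.2 < h)%N.

(** The horizontal displacement is at least [s], so that the strip of obstacles can be measured
    column by column. *)
Definition grid_ell : rel C := fun c c' =>
  [&& low_quadrant c, s%:R <= dx c c', dx c c' < 2 * s%:R,
      0 <= dy c c' & dy c c' < s%:R].

(** The determinant is twice the signed area of the triangle [c], [c'], [u]; bounding it gives a
    strip around the line through [c] and [c'], which replaces the ellipse. For [1 <= eps] every
    near cell is an obstacle. *)
Definition grid_obs (c c' u : C) : bool := grid_near c u &&
  ((1 <= eps) ||
   (`|dx c c' * dy c u - dy c c' * dx c u| <= 48 * eta * s%:R ^+ 2)).

Lemma grid_near_sym : symmetric grid_near.
Proof.
by move=> c u; rewrite /grid_near /dx /dy distrC [in X in _ && X]distrC.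
Qed.

Lemma grid_obs_near c c' u : grid_obs c c' u -> grid_near c u.
Proof. by case/andP. Qed.

Lemma grid_ell_near c c' : grid_ell c c' -> grid_near c c'.
Proof.
case/and5P => _ h1 h2 h3 h4; have s0 : 0 <= s%:R :> R by [].
by rewrite /grid_near !ler_norml; apply/andP; split; apply/andP; split; lra.
Qed.

Lemma card_near_columns c : 1 <= s%:R :> R ->
  #|[pred x : 'I_(2 * h) | `|x%:R - c.1%:R| <= 12 * s%:R :> R]|%:R <= 25 * s%:R :> R.
Proof.
move=> s1; have le : 24 * s%:R + 1 <= 25 * s%:R :> R by lra.
apply: le_trans le; apply: card_interval_le => [|i j]; first by rewrite mulr_ge0.
by rewrite /= !ler_norml => /andP[? ?] /andP[? ?]; lra.
Qed.

Lemma card_near c : 1 <= s%:R :> R ->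
  #|grid_near c|%:R <= 625 * s%:R ^+ 2 :> R.
Proof.
move=> s1; have le : 25 * s%:R * (25 * s%:R) <= 625 * s%:R ^+ 2 :> R by lra.
apply: le_trans le.
apply: (le_trans (@card_pairs_le R _ _ (grid_near c)
  [pred x : 'I_(2 * h) | `|x%:R - c.1%:R| <= 12 * s%:R :> R] (25 * s%:R) _ _)).
- by move=> u /= /andP[].
- have le : 24 * s%:R + 1 <= 25 * s%:R :> R by lra.
  move=> x; apply: le_trans le.
  apply: card_interval_le => [|i j]; first by rewrite mulr_ge0.
  rewrite /= /grid_near /dy /= !ler_norml => /andP[_ /andP[? ?]] /andP[_ /andP[? ?]].
  lra.
- by rewrite ler_wpM2r ?mulr_ge0 ?card_near_columns.
Qed.

(** In one column the strip has height at most [96 * eta * s], hence at most [97 * eta * s] cells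
    because [1 <= eta * s]; there are at most [25 * s] columns, and [25 * 97 = 2425]. *)
Lemma card_obs c c' : 1 <= s%:R :> R -> 0 < eta -> 1 <= eta * s%:R ->
  (1 <= eps -> eta = 1) -> grid_ell c c' ->
  #|grid_obs c c'|%:R <= 2425 * eta * s%:R ^+ 2 :> R.
Proof.
move=> s1 eta_gt0 eta_s eta_big /and5P[_ a1 a2 b1 b2].
have [eps1|eps1] := leP 1 eps.
  have le : 625 * s%:R ^+ 2 <= 2425 * eta * s%:R ^+ 2 :> R.
    by rewrite (eta_big eps1); have := sqr_ge0 (s%:R : R); lra.
  apply: le_trans le.
  apply: le_trans (card_near c s1); rewrite ler_nat; apply/subset_leq_card.
  by apply/fintype.subsetP => u; exact: grid_obs_near.
have le : 25 * s%:R * (97 * eta * s%:R) <= 2425 * eta * s%:R ^+ 2 :> R by lra.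
apply: le_trans le.
apply: (le_trans (@card_pairs_le R _ _ (grid_obs c c')
  [pred x : 'I_(2 * h) | `|x%:R - c.1%:R| <= 12 * s%:R :> R]
  (97 * eta * s%:R) _ _)).
- by move=> u /= /andP[/andP[]].
- have le : 96 * eta * s%:R + 1 <= 97 * eta * s%:R :> R by lra.
  move=> x; apply: le_trans le.
  apply: card_interval_le => [|i j]; first by rewrite !mulr_ge0 // ltW.
  rewrite /= /grid_obs leNgt eps1 /= => /andP[_]; rewrite ler_norml => /andP[H1 _].
  move=> /andP[_]; rewrite ler_norml => /andP[_ H2].
  move: H1 H2; rewrite {1 3}/dy {2 4}/dx /= => H1 H2.
  have a0 : 0 < dx c c' by lra.
  (* This product supplies the nonlinear fact needed to divide the width [96 * eta * s ^+ 2] by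
     [dx c c'], which is at least [s]. *)
  have H : 0 <= (dx c c' - s%:R) * (eta * s%:R).
    by rewrite mulr_ge0 ?subr_ge0 //; lra.
  by rewrite -(ler_pM2l a0); lra.
- by rewrite ler_wpM2r ?card_near_columns ?mulr_ge0 // ltW.
Qed.

(** The displacements [(s + a, b)] with [a, b < s] are all admissible; from the lower left quadrant
    they stay in the grid because [3 * s <= h]. *)
Lemma card_ell c : (3 * s <= h)%N -> low_quadrant c ->
  s%:R ^+ 2 <= #|grid_ell c|%:R :> R.
Proof.
move=> s_le_h /[dup] lq /andP[c1 c2].
have bx (a : 'I_s) : (c.1 + s + a < 2 * h)%N by have := ltn_ord a; lia.
have by_ (a : 'I_s) : (c.2 + a < 2 * h)%N by have := ltn_ord a; lia.
pose f (a : 'I_s * 'I_s) : C := (Ordinal (bx a.1), Ordinal (by_ a.2)).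
have f_inj : injective f.
  move=> [a b] [a' b'] [/addnI aa' /addnI bb'].
  by congr pair; apply: val_inj.
rewrite -natrX ler_nat -[X in (X <= _)%N](_ : #|{: 'I_s * 'I_s}| = _)%N; last first.
  by rewrite card_prod card_ord.
rewrite -(card_codom f_inj); apply/subset_leq_card/fintype.subsetP => _ /codomP[[a b] ->].
rewrite unfold_in /grid_ell lq /dx /dy /= !natrD.
have := ltn_ord a; rewrite -(ltr_nat R) => aS; have := ltn_ord b; rewrite -(ltr_nat R) => bS.
have a0 : 0 <= a%:R :> R by []; have b0 : 0 <= b%:R :> R by [].
by apply/and4P; split; lra.
Qed.

Lemma card_low_quadrant : #|low_quadrant| = (h ^ 2)%N.
Proof.
have w (a : 'I_h) : (a < 2 * h)%N by have := ltn_ord a; lia.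
pose f (a : 'I_h * 'I_h) : C := (Ordinal (w a.1), Ordinal (w a.2)).
have f_inj : injective f.
  by move=> [a b] [a' b'] [aa' bb']; congr pair; apply: val_inj.
rewrite -[RHS](_ : #|{: 'I_h * 'I_h}| = _)%N; last by rewrite card_prod card_ord.
rewrite -(card_codom f_inj); apply: eq_card => -[x y].
apply/idP/codomP => [/andP[/= xh yh]|[[a b] [-> ->]]]; last first.
  by rewrite unfold_in /low_quadrant /= !ltn_ord.
by exists (Ordinal xh, Ordinal yh); rewrite /f; congr pair; apply: val_inj.
Qed.

End Grid.

(** * Spanners and detours *)

Section SpannerDarts.
Context {R : realType} {V : finType}.
Implicit Types (E : {set {set V}}) (len : V -> V -> R).

(** The slack between [1 + eps] and [1 + 2 * eps] makes the inequality strict, so a path can be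
    extracted from the infimum. It is not the trivial path since [i != j]. *)
Lemma spanner_path (eps : R) E E' len i j : 0 < eps -> 0 < len i j -> i != j ->
  [set i; j]%SET \in E -> spanner (1 + eps) E len E' ->
  exists u q, is_path E' i j (u :: q) /\
    path_length len i (u :: q) < (1 + 2 * eps) * len i j.
Proof.
move=> eps0 lij ij ijE [_ /(_ i j) E'E].
have dE : (graph_dist E len i j <= (len i j)%:E)%E.
  apply: ereal_inf_lbound; exists [:: j]; last by rewrite /= addr0.
  by split => //=; rewrite ?inE ?andbT //.
have : (graph_dist E' len i j < ((1 + 2 * eps) * len i j)%:E)%E.
  apply: (le_lt_trans E'E).
  apply: (@le_lt_trans _ _ ((1 + eps)%:E * (len i j)%:E)%E).
    by rewrite lee_pmul2l // lte_fin addr_gt0.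
  rewrite -EFinM lte_fin ltr_pM2r //; lra.
move=> /ereal_inf_lt [_ [[|u q] qP <-]]; rewrite lte_fin => qlt.
  by case: qP => _ _ /= e; rewrite e eqxx in ij.
by exists u, q.
Qed.

Lemma path_length_ge len v q :
  (forall x y z, len x z <= len x y + len y z) -> (forall x, len x x = 0) ->
  len v (last v q) <= path_length len v q.
Proof.
move=> tri len0; elim: q v => [|u q IH] v /=; first by rewrite len0.
by apply: (le_trans (tri v u _)); rewrite lerD2l.
Qed.

(** Each good pair is sent to the dart formed by its tail [i] and the edge from [i] to [f i j]. This
    map is injective, and an edge carries at most two darts. *)
Lemma card_good_le (E' : {set {set V}}) (good : rel V) (f : V -> V -> V) :
  (forall e, e \in E' -> (#|e| <= 2)%N) ->
  (forall i j, good i j -> [set i; f i j]%SET \in E' /\ f i j != i) ->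
  (forall i j j', good i j -> good i j' -> f i j = f i j' -> j = j') ->
  (#|[set a : V * V | good a.1 a.2]%SET| <= 2 * #|E'|)%N.
Proof.
move=> E'2 fE f_inj.
pose D := [set a : V * {set V} | (a.1 \in a.2) && (a.2 \in E')]%SET.
pose phi (a : V * V) := (a.1, [set a.1; f a.1 a.2]%SET).
apply: (@leq_trans #|D|).
  rewrite -(card_in_imset (f := phi)); last first.
    move=> [i j] [i' j']; rewrite !inE /= => g g' [ii'].
    rewrite -{}ii' in g' * => S; congr pair; apply: (f_inj _ _ _ g g').
    have [_ n1] := fE _ _ g; have [_ n2] := fE _ _ g'.
    have : f i j \in [set i; f i j']%SET by rewrite -S !inE eqxx orbT.
    by rewrite !inE (negPf n1) => /eqP.
  apply/subset_leq_card/fintype.subsetP => _ /imsetP[[i j] + ->].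
  by rewrite !inE /= => /fE[-> _]; rewrite eqxx.
rewrite -sum1_card (reindex (fun b : {set V} * V => (b.2, b.1))) /=; last first.
  by exists (fun a => (a.2, a.1)) => -[].
under eq_bigl do rewrite inE /= andbC.
rewrite -(pair_big_dep (fun e => e \in E') (fun e x => x \in e) (fun _ _ => 1%N)) /=.
rewrite mulnC -sum_nat_const; apply: leq_sum => e eE.
by rewrite sum1_card E'2.
Qed.

End SpannerDarts.

(** * Euclidean geometry of the plane *)

Section Euclid.
Context {R : realType}.
Implicit Types (x y z : R * R) (a b c d t : R).

Lemma sqrt_sum_sqr a b : Num.sqrt (a ^+ 2 + b ^+ 2) ^+ 2 = a ^+ 2 + b ^+ 2.
Proof. by rewrite sqr_sqrtr // addr_ge0 ?sqr_ge0. Qed.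

(** Squaring reduces the claim to Cauchy-Schwarz, that is, to the nonnegativity of
    [(a * d - b * c) ^+ 2]. *)
Lemma minkowski2 a b c d :
  Num.sqrt ((a + c) ^+ 2 + (b + d) ^+ 2) <=
  Num.sqrt (a ^+ 2 + b ^+ 2) + Num.sqrt (c ^+ 2 + d ^+ 2).
Proof.
set p := Num.sqrt (a ^+ 2 + _); set r := Num.sqrt (c ^+ 2 + _).
have p0 : 0 <= p := sqrtr_ge0 _.
have r0 : 0 <= r := sqrtr_ge0 _.
have p2 : p ^+ 2 = a ^+ 2 + b ^+ 2 := sqrt_sum_sqr _ _.
have r2 : r ^+ 2 = c ^+ 2 + d ^+ 2 := sqrt_sum_sqr _ _.
rewrite -[leRHS](ger0_norm (addr_ge0 p0 r0)) -sqrtr_sqr ler_wsqrtr //.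
have : a * c + b * d <= p * r.
  apply: (le_trans (ler_norm _)).
  rewrite -ler_sqr ?nnegrE ?mulr_ge0 // real_normK ?num_real // exprMn p2 r2.
  by have := sqr_ge0 (a * d - b * c); nra.
by move=> pr; rewrite [leRHS]sqrrD p2 r2; lra.
Qed.

Lemma eucl_dist_refl x : eucl_dist x x = 0.
Proof. by rewrite /eucl_dist !subrr expr0n /= addr0 sqrtr0. Qed.

Lemma eucl_dist_triangle x y z :
  eucl_dist x z <= eucl_dist x y + eucl_dist y z.
Proof.
apply: le_trans (minkowski2 _ _ _ _); rewrite /eucl_dist.
by rewrite !addrA !subrK.
Qed.

Lemma eucl_dist_scale k x y : 0 <= k ->
  k * eucl_dist x y =
  Num.sqrt ((k * y.1 - k * x.1) ^+ 2 + (k * y.2 - k * x.2) ^+ 2).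
Proof.
move=> k0; rewrite -[k in LHS](ger0_norm k0) -sqrtr_sqr /eucl_dist.
rewrite -sqrtrM ?sqr_ge0 //; congr Num.sqrt; ring.
Qed.

(* Reflecting one of the two legs in the line spanned by v shows that their
   total length is at least that of the hypotenuse with legs |v| and twice the
   distance of u from that line. *)
Lemma ellipse_cross (v1 v2 u1 u2 t : R) :
  Num.sqrt (u1 ^+ 2 + u2 ^+ 2) + Num.sqrt ((v1 - u1) ^+ 2 + (v2 - u2) ^+ 2) <=
    t * Num.sqrt (v1 ^+ 2 + v2 ^+ 2) ->
  4 * (v1 * u2 - v2 * u1) ^+ 2 <= (t ^+ 2 - 1) * (v1 ^+ 2 + v2 ^+ 2) ^+ 2.
Proof.
set p := Num.sqrt (u1 ^+ 2 + _); set r := Num.sqrt ((v1 - u1) ^+ 2 + _).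
set D := Num.sqrt (v1 ^+ 2 + _) => H.
have p0 : 0 <= p := sqrtr_ge0 _.
have r0 : 0 <= r := sqrtr_ge0 _.
have p2 : p ^+ 2 = u1 ^+ 2 + u2 ^+ 2 := sqrt_sum_sqr _ _.
have r2 : r ^+ 2 = (v1 - u1) ^+ 2 + (v2 - u2) ^+ 2 := sqrt_sum_sqr _ _.
have D2 : D ^+ 2 = v1 ^+ 2 + v2 ^+ 2 := sqrt_sum_sqr _ _.
pose d := v1 ^+ 2 + v2 ^+ 2.
(* [A] and [B] are the components of [u] along and across [v], multiplied by the length of [v]. *)
pose A := u1 * v1 + u2 * v2.
pose B := v1 * u2 - v2 * u1.
rewrite -/d -/B; have d0 : 0 <= d by rewrite addr_ge0 ?sqr_ge0.
have pd : p ^+ 2 * d = A ^+ 2 + B ^+ 2 by rewrite p2 /d /A /B; ring.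
have rd : r ^+ 2 * d = (d - A) ^+ 2 + B ^+ 2 by rewrite r2 /d /A /B; ring.
(* Cauchy-Schwarz for [(A, B)] and [(d - A, B)], the second vector being the reflected leg. *)
have prd : A * (d - A) + B ^+ 2 <= p * r * d.
  apply: (le_trans (ler_norm _)).
  rewrite -ler_sqr ?nnegrE ?mulr_ge0 // real_normK ?num_real //.
  have -> : (p * r * d) ^+ 2 = (p ^+ 2 * d) * (r ^+ 2 * d) by ring.
  rewrite pd rd -subr_ge0.
  have -> : (A ^+ 2 + B ^+ 2) * ((d - A) ^+ 2 + B ^+ 2) -
    (A * (d - A) + B ^+ 2) ^+ 2 = (A * B - B * (d - A)) ^+ 2 by ring.
  exact: sqr_ge0.
have H2 : (p + r) ^+ 2 * d <= t ^+ 2 * d * d.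
  rewrite ler_wpM2r //.
  have -> : t ^+ 2 * d = (t * D) ^+ 2 by rewrite exprMn D2.
  by rewrite ler_pXn2r ?nnegrE ?addr_ge0 // (le_trans _ H) ?addr_ge0.
have : (p + r) ^+ 2 * d = p ^+ 2 * d + r ^+ 2 * d + 2 * (p * r * d) by ring.
rewrite pd rd; move: H2 prd; nra.
Qed.

End Euclid.

(** [(a, b)] and [(x, y)] are displacements of cells, [v] and [u] those of the points in them, which
    differ by at most 1 per coordinate. The ellipse bound holds for the points; since
    [1 <= eta * s], the rounding error is absorbed in the constants. *)
Lemma detour_real (R : realType) (a b x y v1 v2 u1 u2 s eta eps : R) :
  1 <= s -> 0 < eta -> 1 <= eta * s -> 0 < eps -> eps < 1 -> eta ^+ 2 = eps ->
  s <= a -> a < 2 * s -> 0 <= b -> b < s ->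
  `|a - v1| <= 1 -> `|b - v2| <= 1 -> `|x - u1| <= 1 -> `|y - u2| <= 1 ->
  Num.sqrt (u1 ^+ 2 + u2 ^+ 2) + Num.sqrt ((v1 - u1) ^+ 2 + (v2 - u2) ^+ 2) <=
    (1 + 2 * eps) * Num.sqrt (v1 ^+ 2 + v2 ^+ 2) ->
  [/\ `|x| <= 12 * s, `|y| <= 12 * s & `|a * y - b * x| <= 48 * eta * s ^+ 2].
Proof.
move=> s1 eta0 etas eps0 eps1 etaE a1 a2 b1 b2 dv1 dv2 du1 du2 H.
have v1s : `|v1| <= 3 * s.
  by move: dv1; rewrite !ler_norml => /andP[? ?]; apply/andP; split; lra.
have v2s : `|v2| <= 2 * s.
  by move: dv2; rewrite !ler_norml => /andP[? ?]; apply/andP; split; lra.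
have sqr_le (p q : R) : `|p| <= q -> p ^+ 2 <= q ^+ 2.
  by move=> pq; rewrite -real_normK ?num_real // ler_sqr ?nnegrE // (le_trans _ pq).
set d := v1 ^+ 2 + v2 ^+ 2.
have d13 : d <= 13 * s ^+ 2.
  by have := sqr_le _ _ v1s; have := sqr_le _ _ v2s; rewrite /d !exprMn; lra.
have d0 : 0 <= d by rewrite addr_ge0 ?sqr_ge0.
(* As [1 + 2 * eps <= 3] and [d <= 13 * s ^+ 2], the squared length of [u] is at most
   [117 * s ^+ 2], below [(11 * s) ^+ 2]; rounding then gives 12. *)
have uN : Num.sqrt (u1 ^+ 2 + u2 ^+ 2) <= 3 * Num.sqrt d.
  apply: (le_trans (le_trans _ H)); first by rewrite lerDl sqrtr_ge0.
  by rewrite ler_wpM2r ?sqrtr_ge0 //; lra.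
have u2N : u1 ^+ 2 + u2 ^+ 2 <= 9 * d.
  rewrite -sqrt_sum_sqr; apply: (@le_trans _ _ ((3 * Num.sqrt d) ^+ 2)).
    by rewrite ler_sqr ?nnegrE ?mulr_ge0 ?sqrtr_ge0.
  by rewrite exprMn sqr_sqrtr //; lra.
have le11 (p : R) : p ^+ 2 <= (11 * s) ^+ 2 -> `|p| <= 11 * s.
  by rewrite -[p ^+ 2]real_normK ?num_real // ler_sqr ?nnegrE //; lra.
have s20 := sqr_ge0 s.
have s0 : 0 <= s by lra.
have u1s : `|u1| <= 11 * s.
  by apply: le11; rewrite exprMn; have := sqr_ge0 u2; lra.
have u2s : `|u2| <= 11 * s.
  by apply: le11; rewrite exprMn; have := sqr_ge0 u1; lra.
have xs : `|x| <= 12 * s.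
  by rewrite -(subrK u1 x) (le_trans (ler_normD _ _)) //; lra.
have ys : `|y| <= 12 * s.
  by rewrite -(subrK u2 y) (le_trans (ler_normD _ _)) //; lra.
split => //.
(* The constant 19 comes from [8 * 169 / 4 = 338 <= 19 ^ 2]. *)
have B19 : `|v1 * u2 - v2 * u1| <= 19 * eta * s ^+ 2.
  have eta_s0 : 0 <= 19 * eta * s ^+ 2 by rewrite !mulr_ge0 ?sqr_ge0 // ltW.
  rewrite -ler_sqr ?nnegrE // real_normK ?num_real //.
  have := ellipse_cross H; rewrite -/d => B4.
  have dd : d ^+ 2 <= 169 * (s ^+ 2) ^+ 2.
    have -> : 169 * (s ^+ 2) ^+ 2 = (13 * s ^+ 2) ^+ 2 by ring.
    by rewrite ler_sqr ?nnegrE // mulr_ge0.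
  have t8 : (1 + 2 * eps) ^+ 2 - 1 <= 8 * eps.
    have : 0 <= eps * (1 - eps) by rewrite mulr_ge0 // ltW // subr_gt0.
    lra.
  have B5 : 4 * (v1 * u2 - v2 * u1) ^+ 2 <= 8 * eps * (169 * (s ^+ 2) ^+ 2).
    apply: (le_trans B4); apply: (le_trans (ler_wpM2r (sqr_ge0 d) t8)).
    by rewrite ler_wpM2l // mulr_ge0 // ltW.
  have -> : (19 * eta * s ^+ 2) ^+ 2 = 361 * eps * (s ^+ 2) ^+ 2.
    by rewrite -etaE; ring.
  have : 0 <= eps * (s ^+ 2) ^+ 2 by rewrite mulr_ge0 ?sqr_ge0 // ltW.
  lra.
(* The four rounding terms are at most [12 s], [3 s], [12 s] and [2 s]; their sum [29 s] is at most
   [29 * eta * s ^+ 2], and [19 + 29 = 48]. *)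
have -> : a * y - b * x = (v1 * u2 - v2 * u1) + (a - v1) * y + v1 * (y - u2)
    - (b - v2) * x - v2 * (x - u1) by ring.
have prod_le (p q m k : R) : `|p| <= m -> `|q| <= k -> `|p * q| <= m * k.
  by move=> pm qk; rewrite normrM ler_pM.
have e1 := prod_le _ _ _ _ dv1 ys.
have e2 := prod_le _ _ _ _ v1s du2.
have e3 := prod_le _ _ _ _ dv2 xs.
have e4 := prod_le _ _ _ _ v2s du1.
have ss : s <= eta * s ^+ 2.
  by rewrite expr2 mulrA -[leLHS]mul1r ler_wpM2r //; lra.
move: B19 e1 e2 e3 e4; rewrite !ler_norml.
move=> /andP[? ?] /andP[? ?] /andP[? ?] /andP[? ?] /andP[? ?].
by apply/andP; split; lra.
Qed.

Lemma in_cell_scaled (R : realType) K (c : 'I_K * 'I_K) (x : R * R) :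
  in_cell c x -> [/\ c.1%:R <= K%:R * x.1, K%:R * x.1 < c.1%:R + 1,
    c.2%:R <= K%:R * x.2 & K%:R * x.2 < c.2%:R + 1].
Proof.
have K0 : 0 < K%:R :> R by rewrite ltr0n (leq_ltn_trans _ (ltn_ord c.1)).
rewrite /in_cell !ler_pdivrMr // !ltr_pdivlMr // -!natr1 ![x.1 * _]mulrC ![x.2 * _]mulrC.
by case/and4P.
Qed.

(** Scaling by [2 * h] makes the cells unit squares, which reduces the claim to [detour_real]. *)
Lemma detour_obs (R : realType) h s (eta eps : R)
    (c c' cu : 'I_(2 * h) * 'I_(2 * h)) (xi xj xu : R * R) :
  1 <= s%:R :> R -> 0 < eta -> 1 <= eta * s%:R -> 0 < eps -> eps < 1 ->
  eta ^+ 2 = eps -> grid_ell (R := R) s c c' ->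
  in_cell c xi -> in_cell c' xj -> in_cell cu xu ->
  eucl_dist xi xu + eucl_dist xu xj <= (1 + 2 * eps) * eucl_dist xi xj ->
  grid_obs s eta eps c c' cu.
Proof.
move=> s1 eta0 etas eps0 eps1 etaE /and5P[_ a1 a2 b1 b2].
move=> /in_cell_scaled[i1 i2 i3 i4] /in_cell_scaled[j1 j2 j3 j4].
move=> /in_cell_scaled[u1 u2 u3 u4].
set k : R := (2 * h)%:R in i1 i2 i3 i4 j1 j2 j3 j4 u1 u2 u3 u4.
have k0 : 0 <= k by [].
move=> /(ler_wpM2l k0); rewrite mulrDr mulrCA !eucl_dist_scale //.
have -> : k * xj.1 - k * xu.1 = k * xj.1 - k * xi.1 - (k * xu.1 - k * xi.1) by ring.
have -> : k * xj.2 - k * xu.2 = k * xj.2 - k * xi.2 - (k * xu.2 - k * xi.2) by ring.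
move=> H; have [|||| x12 y12 cr] := @detour_real R (dx c c') (dy c c') (dx c cu)
  (dy c cu) _ _ _ _ s%:R eta eps s1 eta0 etas eps0 eps1 etaE a1 a2 b1 b2 _ _ _ _ H;
  rewrite /dx /dy ?ler_norml; try by apply/andP; split; lra.
by rewrite /grid_obs /grid_near x12 y12 cr orbT.
Qed.

Lemma ell_dist_gt0 (R : realType) h s
    (c c' : 'I_(2 * h) * 'I_(2 * h)) (xi xj : R * R) :
  1 <= s%:R :> R -> grid_ell (R := R) s c c' -> in_cell c xi -> in_cell c' xj ->
  0 < eucl_dist xi xj.
Proof.
move=> s1 /and5P[_ a1 _ _ _].
move=> /in_cell_scaled[_ i2 _ _] /in_cell_scaled[j1 _ _ _].
rewrite sqrtr_gt0 ltr_wpDr ?sqr_ge0 // exprn_even_gt0 //= subr_eq0.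
apply/eqP => e; move: a1; rewrite /dx; move: i2 j1; rewrite e => ? ?; lra.
Qed.

(** * Measurability of the spanner event *)

Section EventMeasurability.
Context {d : measure_display} {T : measurableType d} {R : realType}.
Context {P : probability T R} {n : nat}.
Context (X : 'I_n -> {RV P >-> (R * R)%type}) (Y : vpair n -> {RV P >-> bool}).
Implicit Types (E : {set {set 'I_n}}).

Lemma measurable_len i j : measurable_fun setT (fun w => random_len X w i j).
Proof.
have m1 k : measurable_fun setT (fun w => (X k w).1).
  by apply: measurableT_comp; [exact: measurable_fst | exact: measurable_funPT].
have m2 k : measurable_fun setT (fun w => (X k w).2).
  by apply: measurableT_comp; [exact: measurable_snd | exact: measurable_funPT].
apply: (@measurableT_comp _ _ _ _ _ _ (@Num.sqrt R)).
  apply: continuous_measurable_fun; exact: sqrt_continuous.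
by apply: measurable_funD; apply: measurable_funX; apply: measurable_funB.
Qed.

Lemma measurable_path_length q v :
  measurable_fun setT (fun w => path_length (random_len X w) v q).
Proof.
elim: q v => [|u q IH] v /=; first exact: measurable_cst.
by apply: measurable_funD; [exact: measurable_len | exact: IH].
Qed.

(** Vertex lists are enumerated through [unpickle], so the distance is the infimum of a sequence of
    measurable functions, equal to [+oo] at the codes of no path. *)
Lemma measurable_graph_dist E v u :
  measurable_fun setT (fun w => graph_dist E (random_len X w) v u).
Proof.
pose h (k : nat) w : \bar R :=
  if (unpickle k : option (seq 'I_n)) is Some q then
    if `[< is_path E v u q >] then (path_length (random_len X w) v q)%:E else +oo%E
  else +oo%E.
have mh k : measurable_fun setT (h k).
  rewrite /h; case: unpickle => [q|]; last exact: measurable_cst.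
  case: asboolP => _; last exact: measurable_cst.
  by apply/measurable_EFinP; exact: measurable_path_length.
rewrite (_ : (fun w => _) = (fun w => einfs (h ^~ w) 0%N)).
  exact: measurable_fun_einfs.
apply/funext => w; rewrite /einfs /= /graph_dist; apply/eqP.
rewrite eq_le; apply/andP; split.
  apply: le_ereal_inf_tmp => _ [k _ <-]; rewrite /h.
  case: unpickle => [q|]; last by rewrite leey.
  case: asboolP => [qP|_]; last by rewrite leey.
  by apply: ereal_inf_lbound; exists q.
apply: le_ereal_inf_tmp => _ [q qP <-].
apply: ereal_inf_lbound; exists (pickle q) => //.
by rewrite /h pickleK asboolT.
Qed.

(** There are finitely many candidates [E'] and finitely many values [F] of the edge set; for fixed
    [E'] and [F], being a spanner amounts to finitely many inequalities between measurable
    distances. *)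
Lemma measurable_spanner_event t (Q : pred {set {set 'I_n}}) :
  measurable [set w | forall E',
    spanner t (random_edges Y w) (random_len X w) E' -> Q E'].
Proof.
pose D E' F := [set w | spanner t F (random_len X w) E'].
have mD E' F : measurable (D E' F).
  have [sub|nsub] := boolP (E' \subset F); last first.
    rewrite (_ : D E' F = set0) //.
    by apply/seteqP; split => // w [sub]; rewrite sub in nsub.
  rewrite (_ : D E' F = \bigcap_(v in setT) \bigcap_(u in setT)
     [set w | graph_dist E' (random_len X w) v u <=
        t%:E * graph_dist F (random_len X w) v u]%E).
    apply: fin_bigcap_measurable => // v _; apply: fin_bigcap_measurable => // u _.
    rewrite -[X in measurable X]setTI.
    apply: measurable_lee => //; first exact: measurable_graph_dist.
    by apply: measurable_funeM; exact: measurable_graph_dist.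
  by apply/seteqP; split => [w [_ H] v _ u _|w H]; [exact: H | split=> // v u; exact: H].
(* Equality with [F] means agreement on every pair, together with the deterministic condition that
   [F] consists of pairs. *)
have mE F : measurable [set w | random_edges Y w = F].
  rewrite (_ : [set w | _] =
      \bigcap_(e in setT) [set w | Y e w = (val e \in F)] `&`
      [set w | forall f, f \in F -> exists e : vpair n, val e = f]); last first.
    apply/seteqP; split => [w <-|w [H1 H2]].
      split => [e _|f /imsetP[e _ ->]]; last by exists e.
      rewrite /= /random_edges; apply/idP/imsetP => [Ye|[e' + /val_inj ->]].
        by exists e; rewrite ?inE.
      by rewrite inE.
    apply/setP => f; apply/imsetP/idP => [[e + ->]|fF].
      by rewrite inE (H1 e) .
    by have [e ef] := H2 f fF; exists e => //; rewrite inE (H1 e) // ef.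
  apply: measurableI.
    apply: fin_bigcap_measurable => [|e _]; first exact: finite_finset.
    rewrite -[X in measurable X]setTI.
    rewrite (_ : [set w | _] = Y e @^-1` [set (val e \in F)]) //.
    exact: measurable_funPT.
  have [H|H] := pselect (forall f, f \in F -> exists e : vpair n, val e = f).
    by rewrite (_ : [set w | _] = setT) //; apply/seteqP; split.
  by rewrite (_ : [set w | _] = set0) //; apply/seteqP; split.
rewrite (_ : [set w | _] = \bigcap_(E' in setT) \bigcup_(F in setT)
   ([set w | random_edges Y w = F] `&` [set w | spanner t F (random_len X w) E' -> Q E'])).
  apply: fin_bigcap_measurable => // E' _; apply: fin_bigcup_measurable => // F _.
  apply: measurableI => //.
  case: (Q E'); first by rewrite (_ : [set w | _] = setT) //; apply/seteqP; split.
  rewrite (_ : [set w | _] = ~` D E' F); first exact: measurableC.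
  by apply/seteqP; split => w /=; [move=> H /H | move=> H /H].
apply/seteqP; split => [w H E' _|w H E' E'P].
  by exists (random_edges Y w) => //; split => //=; exact: H.
by have [F _ [/= <-]] := H E' I; apply.
Qed.

End EventMeasurability.

(** * The random geometric graph on a grid *)

Section Located.
Context {C : finType}.
(** One value type serves both kinds of coordinates: an optional cell for a point, a Boolean for a
    pair. *)
Let V : finType := (option C + bool)%type.
Implicit Types v : V.

Definition at_cell (Q : pred C) v : bool := if v is inl (Some c) then Q c else false.

Definition cell_rel (r : rel C) : rel V := fun v v' =>
  if v is inl (Some c) then at_cell (r c) v' else false.

Definition cell_rel3 (o : C -> C -> C -> bool) (v v' u : V) : bool :=
  if v is inl (Some c) then
    if v' is inl (Some c') then at_cell (o c c') u else false
  else false.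

Definition edge_on v : bool := if v is inr b then b else false.

Lemma cell_rel_sym r : symmetric r -> symmetric (cell_rel r).
Proof. by move=> rC [[c|]|b] [[c'|]|b'] //=; exact: rC. Qed.

Lemma card_at_cell Q : #|at_cell Q| = #|Q|.
Proof.
have inj : injective (fun c => inl (Some c) : V) by move=> c c' [].
rewrite -(fintype.card_image inj); apply: eq_card => v.
apply/idP/fintype.imageP => [|[c Qc ->]] //.
by case: v => [[c|]|b] // Qc; exists c.
Qed.

Lemma sum_at_cell (R : realFieldType) (f : V -> R) (kappa : R) Q :
  (forall c, f (inl (Some c)) = kappa) ->
  \sum_v f v * (at_cell Q v)%:R = kappa * #|Q|%:R.
Proof.
move=> fk; rewrite -card_at_cell -sum1_card natr_sum mulr_sumr [RHS]big_mkcond.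
apply: eq_bigr => v _ /=; rewrite -[v \in _]/(at_cell Q v) mulr1.
by case: ifPn => [|_]; [case: v => [[c|]|b] //= _; rewrite fk mulr1|rewrite mulr0].
Qed.

End Located.

(** * Good pairs and spanner edges in the discretised model *)

Section Model.
Context {d : measure_display} {T : measurableType d} {R : realType}.
Context {P : probability T R} {n : nat}.
Context (X : 'I_n -> {RV P >-> (R * R)%type}) (Y : vpair n -> {RV P >-> bool}).
Context (p : R) (h s : nat) (eta eps : R).
Let C : finType := ('I_(2 * h) * 'I_(2 * h))%type.
Let V : finType := (option C + bool)%type.

Definition located (k : 'I_n + vpair n) (w : T) : V :=
  match k with
  | inl i => inl (cell_of (2 * h) (X i w))
  | inr e => inr (Y e w)
  end.

Let near : rel V := cell_rel (grid_near (R := R) s).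
Let ell : rel V := cell_rel (grid_ell (R := R) s).
Let obs : V -> V -> V -> bool := cell_rel3 (grid_obs s eta eps).

Lemma joined_located w i j : i != j ->
  joined edge_on [ffun k => located k w] i j =
  ([set i; j]%SET \in random_edges Y w).
Proof.
move=> ij; have [e eE jE] := vpair_ex (@edge_on C) ij.
rewrite jE ffunE /= -eE.
apply/idP/imsetP => [Ye|[e' + /val_inj ->]]; last by rewrite inE.
by exists e; rewrite ?inE.
Qed.

(** Every good pair yields a spanner edge at its tail. For [eps < 1] it is the pair itself, since
    any other first step of a short path would block; for [1 <= eps] each vertex is the tail of at
    most one good pair. Either way the darts are distinct. *)
Lemma links_blocked_spanner w (E' : {set {set 'I_n}}) :
  1 <= s%:R :> R -> 0 < eta -> 1 <= eta * s%:R -> 0 < eps ->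
  (eps < 1 -> eta ^+ 2 = eps) ->
  (forall i, cell_of (2 * h) (X i w) != None) ->
  spanner (1 + eps) (random_edges Y w) (random_len X w) E' ->
  links edge_on ell [ffun k => located k w] -
  blocked edge_on ell obs [ffun k => located k w] <= 2 * #|E'|%:R :> R.
Proof.
move=> s1 eta0 etas eps0 etaE loc sp; set z := [ffun k => located k w].
apply: (le_trans (links_blocked_le edge_on ell obs z)); rewrite -natrM ler_nat.
have loc_i i : exists2 c : C, z (inl i) = inl (Some c) & in_cell c (X i w).
  rewrite ffunE /=; case E: cell_of (loc i) => [c|] // _.
  by exists c => //; exact: cell_ofP.
have ellP i j : ell (z (inl i)) (z (inl j)) -> exists c c' : C,
    [/\ z (inl i) = inl (Some c), z (inl j) = inl (Some c'), grid_ell (R := R) s c c',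
        in_cell c (X i w) & in_cell c' (X j w)].
  have [c zi ci] := loc_i i; have [c' zj cj] := loc_i j.
  by rewrite zi zj => e; exists c, c'.
have obs_near i j u : ell (z (inl i)) (z (inl j)) -> ell (z (inl i)) (z (inl u)) ->
    1 <= eps -> obs (z (inl i)) (z (inl j)) (z (inl u)).
  move=> eij eiu eps1; have [c [c' [zi zj _ _ _]]] := @ellP i j eij.
  have [c1 [cu [zi1 zu e _ _]]] := @ellP i u eiu.
  move: zi1; rewrite zi zj zu => -[cc1]; rewrite -cc1 in e.
  by rewrite /obs /= /grid_obs eps1 andbT; apply: grid_ell_near.
have E'E : E' \subset random_edges Y w by case: sp.
(* [u] is the first vertex after [a.1] on a short spanner path to [a.2]; a pair that is not good
   receives an arbitrary value. *)
have step (a : 'I_n * 'I_n) : exists u, good edge_on ell obs z a.1 a.2 ->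
    [/\ [set a.1; u]%SET \in E', u != a.1 & eps < 1 -> u = a.2].
  case: a => i j /=; case: (boolP (good _ _ _ _ _ _)) => [|_]; last by exists i.
  move=> /and3P[jij eij /forallP free].
  have ij := joined_neq jij.
  have [c [c' [zi zj e ci cj]]] := @ellP i j eij.
  have lij : 0 < random_len X w i j by exact: ell_dist_gt0 s1 e ci cj.
  have ijE : [set i; j]%SET \in random_edges Y w by rewrite -joined_located.
  have [u [q [[/= /andP[iu _] uq lq] len]]] := spanner_path eps0 lij ij ijE sp.
  exists u => _.
  have ui : u != i by move: uq; rewrite inE negb_or => /andP[/andP[+ _] _]; rewrite eq_sym.
  split => // eps1; apply/eqP/negPn/negP => uj.
  have := free u; rewrite uj /= joined_located 1?eq_sym //.
  rewrite (fintype.subsetP E'E) //=.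
  have [cu zu cuP] := loc_i u; rewrite zi zj zu /obs /=.
  rewrite (@detour_obs R h s eta eps c c' cu (X i w) (X j w) (X u w)) //.
    exact: etaE.
  (* The rest of the path is at least as long as the segment from [u] to [j], so [u] lies in the
     ellipse. *)
  apply: ltW; apply: le_lt_trans len; rewrite lerD2l -lq.
  apply: path_length_ge => [a b b'|a]; first exact: eucl_dist_triangle.
  exact: eucl_dist_refl.
have [f fP] := choice step.
apply: (@card_good_le _ E' _ (fun i j => f (i, j))).
- move=> e /(fintype.subsetP E'E)/imsetP[e' _ ->].
  by rewrite (eqP (valP e')).
- by move=> i j /(fP (i, j))[].
- move=> i j j' g g' ff; have [_ _ fj] := fP (i, j) g; have [_ _ fj'] := fP (i, j') g'.
  have [eps1|eps1] := ltP eps 1; first by rewrite -[j]fj // -[j']fj'.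
  (* For [1 <= eps] a second link from [i], to [j'], would block the link to [j]. *)
  apply/eqP/negPn/negP => jj'.
  case/and3P: g => _ e /forallP/(_ j'); rewrite eq_sym jj' /=.
  by case/and3P: g' => -> e' _; rewrite (@obs_near i j j' e e').
Qed.

Hypothesis model : random_geometric_model X Y p.

Lemma measurable_located k v : measurable (located k @^-1` [set v]).
Proof.
case: k v => [i|e] [c|b] /=.
- rewrite (_ : _ @^-1` _ = X i @^-1` (cell_of (2 * h) @^-1` [set c])).
    rewrite -[X in measurable X]setTI; apply: measurable_funPT => //.
    exact: measurable_cell_of.
  by apply/seteqP; split => w /= => [[]|->].
- by rewrite (_ : _ @^-1` _ = set0) //; apply/seteqP; split.
- by rewrite (_ : _ @^-1` _ = set0) //; apply/seteqP; split.
- rewrite (_ : _ @^-1` _ = Y e @^-1` [set b]).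
    by rewrite -[X in measurable X]setTI; apply: measurable_funPT.
  by apply/seteqP; split => w /= => [[]|->].
Qed.

Lemma sigma_located k v :
  (match k with inl i => sigma_of (X i) | inr e => sigma_of (Y e) end)
  (located k @^-1` [set v]).
Proof.
case: k v => [i|e] [c|b] /=.
- exists (cell_of (2 * h) @^-1` [set c]); first exact: measurable_cell_of.
  by apply/seteqP; split => w /= => [[_ ->]|[]].
- by exists set0 => //; apply/seteqP; split => w [].
- by exists set0 => //; apply/seteqP; split => w [].
- by exists [set b] => //; apply/seteqP; split => w /= => [[_ ->]|[]].
Qed.

Let m := law P located.
Let m_ge0 k v : 0 <= m k v. Proof. exact: law_ge0. Qed.
Let m_sum1 k : \sum_v m k v = 1.
Proof. exact: law_sum1 measurable_located k. Qed.

Lemma law_cell i (c : C) : m (inl i) (inl (Some c)) = ((2 * h)%:R ^+ 2)^-1.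
Proof.
case: model => Xu _ _; rewrite /m /law.
rewrite (_ : _ @^-1` _ = (cell_of (2 * h) \o X i) @^-1` [set Some c]).
  by rewrite unif_cell.
by apply/seteqP; split => w /= => [[]|->].
Qed.

Lemma law_edge e : \sum_v m (inr e) v * (edge_on v)%:R = p.
Proof.
apply: (@EFin_inj R); rewrite -(law_sum P measurable_located).
case: model => _ Yp _; by rewrite -(Yp e); congr (P _).
Qed.

(** The [(2 * h) ^ 2] cells already carry total mass 1. *)
Lemma law_outside i : (0 < h)%N -> m (inl i) (inl None) = 0.
Proof.
move=> h0; have K0 : (2 * h)%:R != 0 :> R by rewrite pnatr_eq0; lia.
have := sum_at_cell predT (law_cell i).
rewrite card_prod card_ord mulnn natrX mulVf ?expf_neq0 // => e.
have := m_sum1 (inl i); rewrite -e (bigD1 (inl None)) //= [X in _ = X](bigD1 (inl None)) //=.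
rewrite mulr0 add0r => H.
have le : \sum_(v | v != inl None) m (inl i) v * (at_cell predT v)%:R <=
   \sum_(v | v != inl None) m (inl i) v.
  by apply: ler_sum => v _; rewrite ler_piMr // lern1 leq_b1.
apply/eqP; rewrite eq_le m_ge0 andbT; move: H le; lra.
Qed.

Let q0 : R := s%:R ^+ 2 / (2 * h)%:R ^+ 2.

Let q0_ge0 : 0 <= q0.
Proof. by rewrite mulr_ge0 ?invr_ge0 ?exprn_ge0. Qed.

Lemma near_mass i v : 1 <= s%:R :> R ->
  \sum_u m (inl i) u * (near v u)%:R <= 625 * q0.
Proof.
move=> s1; have kappa0 : 0 <= ((2 * h)%:R ^+ 2)^-1 :> R.
  by rewrite invr_ge0 exprn_ge0.
have rhs0 : 0 <= 625 * q0 by exact: mulr_ge0 (ler0n _ _) q0_ge0.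
case: v => [[c|]|b]; last 2 first.
- by rewrite big1 // => u _; rewrite mulr0.
- by rewrite big1 // => u _; rewrite mulr0.
rewrite (sum_at_cell (grid_near (R := R) s c) (law_cell i)) mulrC /q0 mulrA.
by rewrite ler_wpM2r // card_near.
Qed.

Lemma obs_mass k v v' : 1 <= s%:R :> R -> 0 < eta -> 1 <= eta * s%:R ->
  (1 <= eps -> eta = 1) -> ell v v' ->
  \sum_u m (inl k) u * (obs v v' u)%:R <= 2425 * eta * q0.
Proof.
move=> s1 eta0 etas eta1; have kappa0 : 0 <= ((2 * h)%:R ^+ 2)^-1 :> R.
  by rewrite invr_ge0 exprn_ge0.
case: v v' => [[c|]|b] [[c'|]|b'] //= e.
rewrite (sum_at_cell (grid_obs s eta eps c c') (law_cell k)) mulrC /q0 mulrA.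
by rewrite ler_wpM2r // card_obs.
Qed.

(** The quarter is the probability of the lower left quadrant; [q0] is the mass of the [s ^ 2] cells
    given by [card_ell]. *)
Lemma ell_mass i j : (0 < h)%N -> (3 * s <= h)%N ->
  q0 / 4 <= \sum_v m (inl i) v * \sum_v' m (inl j) v' * (ell v v')%:R.
Proof.
move=> h0 sh; have kappa0 : 0 <= ((2 * h)%:R ^+ 2)^-1 :> R.
  by rewrite invr_ge0 exprn_ge0.
have := sum_at_cell (@low_quadrant h) (law_cell i); rewrite card_low_quadrant => e.
have -> : q0 / 4 = \sum_v m (inl i) v * (at_cell (@low_quadrant h) v)%:R * q0.
  rewrite -mulr_suml e mulrC; congr (_ * _); rewrite natrM natrX.
  by field; rewrite pnatr_eq0; lia.
apply: ler_sum => v _; rewrite -mulrA ler_wpM2l //.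
case: v => [[c|]|b] /=; last 2 first.
- by rewrite mul0r sumr_ge0 // => v _; rewrite mulr_ge0.
- by rewrite mul0r sumr_ge0 // => v _; rewrite mulr_ge0.
rewrite (sum_at_cell (grid_ell (R := R) s c) (law_cell j)).
case: (boolP (low_quadrant c)) => lq; last by rewrite mul0r mulr_ge0.
by rewrite mul1r /q0 mulrC ler_wpM2l // card_ell.
Qed.

(** When all points lie in cells and the difference of the counts is at least [e / 4], every spanner
    has at least [e / 8] edges, where [e >= e0] is the mean number of links. The complementary event
    is bounded by [links_blocked_dev]. *)
Lemma spanner_event_prob (thr : R) (e0 := n%:R * n.-1%:R * (p * (q0 / 4))) :
  (3 * s <= h)%N -> 1 <= s%:R :> R -> 0 < eta -> 1 <= eta * s%:R -> 0 < eps ->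
  (eps < 1 -> eta ^+ 2 = eps) -> (1 <= eps -> eta = 1) -> 0 <= p ->
  n%:R * p * (2425 * eta * q0) <= 2^-1 -> 0 < e0 -> thr <= e0 / 8 ->
  ((1 - 2 * (9 * (4 + n%:R * p * (625 * q0)) ^+ 4 * n%:R) / (e0 / 8) ^+ 2)%:E <=
  P [set w | forall E' : {set {set 'I_n}},
     spanner (1 + eps) (random_edges Y w) (random_len X w) E' ->
     (thr <= #|E'|%:R)%R])%E.
Proof.
move=> sh s1 eta0 etas eps0 eta_sq eta1 p0 small e00 thr_le.
have h0 : (0 < h)%N by apply: leq_trans sh; rewrite muln_gt0 /= -(ler1n R).
have omega0 : 0 <= 2425 * eta * q0.
  exact: mulr_ge0 (mulr_ge0 (ler0n _ _) (ltW eta0)) q0_ge0.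
have q625 : 0 <= 625 * q0 by exact: mulr_ge0 (ler0n _ _) q0_ge0.
have near_sym : symmetric near by apply/cell_rel_sym/grid_near_sym.
have ell_near v v' : ell v v' -> near v v'.
  by case: v v' => [[c|]|b] [[c'|]|b'] //=; exact: grid_ell_near.
have obs_near v v' u : obs v v' u -> near v u.
  by case: v v' u => [[c|]|b] [[c'|]|b'] [[cu|]|bu] //=; exact: grid_obs_near.
set e := mean m (links edge_on ell).
have e0_le : e0 <= e.
  exact: (mean_links_ge m_ge0 m_sum1 law_edge p0 (fun i j _ => ell_mass i j h0 sh)).
have e_gt0 : 0 < e := lt_le_trans e00 e0_le.
have near_q i v := near_mass i v s1.
have obs_q k v v' := @obs_mass k v v' s1 eta0 etas eta1.
have dev := links_blocked_dev m_ge0 m_sum1 law_edge near_sym near_q p0 q625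
  ell_near obs_near obs_q omega0 small e_gt0.
rewrite -/e in dev; set bnd := _ * (_ * _ * n%:R) in dev *.
pose inside_sq (z : {ffun 'I_n + vpair n -> V}) := [forall i, z (inl i) != inl None].
pose G (z : {ffun 'I_n + vpair n -> V}) := inside_sq z &&
  (e / 4 <= links edge_on ell z - blocked edge_on ell obs z).
case: (model) => _ _ indep.
have [mG PG] := finite_law measurable_located G indep sigma_located.
apply: (@le_trans _ _ (P [set w | G [ffun k => located k w]])); last first.
  apply: le_measure; rewrite ?inE //.
    exact: (measurable_spanner_event X Y (1 + eps) (fun E' => thr <= #|E'|%:R)).
  move=> w /andP[/forallP loc big] E' sp.
  have loc' i : cell_of (2 * h) (X i w) != None.
    by have := loc i; rewrite ffunE; apply: contraNneq => /= ->.
  have := links_blocked_spanner s1 eta0 etas eps0 eta_sq loc' sp.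
  move: big thr_le e0_le; lra.
rewrite PG lee_fin -/m.
have total : \sum_z weight m z = 1 := weight_sum1 m_sum1.
have outside : \sum_(z | ~~ inside_sq z) weight m z = 0.
  apply: big1 => z /forallPn[i]; rewrite negbK => /eqP zi.
  by rewrite /weight (bigD1 (inl i)) //= zi law_outside // mul0r.
(* Union bound: a configuration outside [G] has a point in no cell or too small a difference. *)
have split : \sum_z weight m z <= \sum_(z | G z) weight m z + \sum_(z | ~~ inside_sq z) weight m z +
    \sum_(z | links edge_on ell z - blocked edge_on ell obs z < e / 4) weight m z.
  rewrite !(big_mkcond (fun z => G z)) !(big_mkcond (fun z => ~~ _)).
  rewrite (big_mkcond (fun z => _ < _)) -!big_split; apply: ler_sum => z _ /=.
  have := weight_ge0 m_ge0 z; set x := weight m z => x0; rewrite /G ltNge.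
  by case: (inside_sq z); case: (e / 4 <= _); rewrite /= ?add0r ?addr0 ?lerDl.
have base0 : 0 <= 4 + n%:R * p * (625 * q0) :=
  addr_ge0 (ler0n _ 4) (mulr_ge0 (mulr_ge0 (ler0n _ n) p0) q625).
have bnd0 : 0 <= bnd := mulr_ge0 (ler0n _ 2)
  (mulr_ge0 (mulr_ge0 (ler0n _ 9) (exprn_ge0 4 base0)) (ler0n _ n)).
have mono : bnd / (e / 8) ^+ 2 <= bnd / (e0 / 8) ^+ 2.
  rewrite ler_wpM2l // lef_pV2 ?posrE ?exprn_gt0 ?divr_gt0 //.
  by rewrite ler_pXn2r ?nnegrE ?divr_ge0 ?(ltW e_gt0) ?(ltW e00) // ler_pM2r.
rewrite total outside addr0 in split.
move: split (le_trans dev mono); set a := \sum_(z | G z) _; set b := \sum_(z | _) _.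
by move=> ab bb; rewrite lerBlDr (le_trans ab) // lerD2l.
Qed.

End Model.

(** * Choice of the grid and passage to the limit *)

(** Take the least [m] with [M <= m ^ 2]: then [(m - 1) ^ 2 < M], and [m <= 2 * (m - 1)]. *)
Lemma square_between (R : realType) (M : R) : 9 <= M ->
  exists m : nat, [/\ (3 <= m)%N, M <= m%:R ^+ 2 & m%:R ^+ 2 <= 4 * M].
Proof.
move=> M9; have ex : exists m : nat, M <= m%:R ^+ 2.
  have M0 : 0 <= M by lra.
  exists (Num.Def.archi_bound M); set b := Num.Def.archi_bound M.
  have Mb : M < b%:R := archi_boundP M0.
  have b1 : 1 <= b%:R :> R by apply: le_trans (ltW Mb); lra.
  by apply: (le_trans (ltW Mb)); rewrite expr2 ler_peMl // (le_trans _ b1).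
case: (ex_minnP ex) => m Mm min_m.
have m3 : (3 <= m)%N.
  rewrite leqNgt; apply/negP => m2.
  have : (m%:R : R) ^+ 2 <= 2 ^+ 2 by rewrite ler_pXn2r ?nnegrE // ler_nat.
  by move: Mm M9; lra.
exists m; split => //.
have : ~~ (M <= m.-1%:R ^+ 2).
  by apply/negP => /min_m; rewrite leqNgt prednK ?leqnn // (leq_trans _ m3).
rewrite -ltNge => /ltW lt; apply: (@le_trans _ _ (4 * m.-1%:R ^+ 2)).
  have -> : 4 * m.-1%:R ^+ 2 = (2 * m.-1%:R) ^+ 2 :> R by ring.
  rewrite ler_pXn2r ?nnegrE ?mulr_ge0 //.
  by rewrite -natrM ler_nat; lia.
by rewrite ler_wpM2l.
Qed.

(** With [h = s * m] one has [q0 = 1 / (4 * m ^ 2)], and [m ^ 2] is taken between [M] and [4 * M],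
    where [M = n * p * a * eta / 2]. The lower bound on [m ^ 2] keeps blocking rare, the upper one
    keeps links frequent; 18 makes [M >= 9], hence [m >= 3]. *)
Lemma grid_size (R : realType) (a eta p : R) (n s : nat) :
  0 < a -> 0 < eta -> (2 <= n)%N -> (0 < s)%N -> 18 / (a * eta) <= n%:R * p ->
  exists h, let q0 : R := s%:R ^+ 2 / (2 * h)%:R ^+ 2 in
  [/\ (3 * s <= h)%N, n%:R * p * (a * eta * q0) <= 2^-1 &
      n%:R / (64 * a * eta) <= n%:R * n.-1%:R * (p * (q0 / 4))].
Proof.
move=> a0 eta0 n2 s0 np.
have n1 : n%:R / 2 <= n.-1%:R :> R.
  by rewrite ler_pdivrMr // -natrM ler_nat; clear -n2; lia.
have ae : 0 < a * eta by rewrite mulr_gt0.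
set M := n%:R * p * (a * eta) / 2.
have M9 : 9 <= M.
  by move: np; rewrite ler_pdivrMr // /M; lra.
have [m [m3 Mm mM]] := square_between M9.
exists (s * m)%N => q0.
have m0 : 0 < m%:R :> R by rewrite ltr0n (leq_trans _ m3).
have s0' : s%:R != 0 :> R by rewrite pnatr_eq0 -lt0n.
have q0E : q0 = (4 * m%:R ^+ 2)^-1.
  by rewrite /q0 !natrM; field; rewrite s0' lt0r_neq0.
have m20 : 0 < 4 * m%:R ^+ 2 :> R by rewrite mulr_gt0 // exprn_gt0.
have npE : n%:R * p = 2 * M / (a * eta).
  by rewrite /M; field; rewrite !lt0r_neq0.
split; first by rewrite mulnC leq_mul.
  rewrite q0E npE.
  have -> : 2 * M / (a * eta) * (a * eta * (4 * m%:R ^+ 2)^-1) =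
      2 * M / (4 * m%:R ^+ 2) by field; rewrite !lt0r_neq0.
  by rewrite ler_pdivrMr //; lra.
have -> : n%:R * n.-1%:R * (p * (q0 / 4)) = n.-1%:R * (n%:R * p * q0 / 4) by ring.
have key : (16 * (a * eta))^-1 * 2^-1 <= n%:R * p * q0 / 4.
  rewrite npE q0E.
  have -> : 2 * M / (a * eta) / (4 * m%:R ^+ 2) / 4 =
      (a * eta)^-1 * (M / (8 * m%:R ^+ 2)).
    by field; rewrite !lt0r_neq0.
  rewrite invfM -mulrA [16^-1 * _]mulrCA ler_wpM2l ?invr_ge0 ?(ltW ae) //.
  by rewrite ler_pdivlMr; lra.
have k0 : 0 <= (16 * (a * eta))^-1 * 2^-1 :> R.
  by rewrite mulr_ge0 // invr_ge0 mulr_ge0 // ltW.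
apply: le_trans (ler_wpM2r (le_trans k0 key) n1).
have -> : n%:R / (64 * a * eta) = n%:R / 2 * ((16 * (a * eta))^-1 * 2^-1).
  by field; rewrite !lt0r_neq0.
by rewrite ler_wpM2l ?mulr_ge0 ?invr_ge0.
Qed.

(** The left side is at most [18 * B ^+ 4 / (g ^+ 2 * n)]. The factor doubles to 36 because
    [harmonic n] is [1 / (n + 1)] and [n + 1 <= 2 * n]. *)
Lemma failure_le_harmonic (R : realType) (n : nat) (b B E g : R) :
  0 <= b -> b <= B -> (0 < n)%N -> 0 < g -> g * n%:R <= E ->
  2 * (9 * b ^+ 4 * n%:R) / E ^+ 2 <= (36 * B ^+ 4 / g ^+ 2) * harmonic n.
Proof.
move=> b0 bB n0 g0 gE; have n0' : 0 < n%:R :> R by rewrite ltr0n.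
have gn : 0 < g * n%:R by rewrite mulr_gt0.
apply: (@le_trans _ _ (2 * (9 * B ^+ 4 * n%:R) / (g * n%:R) ^+ 2)).
  apply: ler_pM.
  - by rewrite !mulr_ge0 // exprn_ge0.
  - by rewrite invr_ge0 sqr_ge0.
  - rewrite ler_wpM2l // ler_wpM2r // ler_wpM2l //.
    by rewrite ler_pXn2r ?nnegrE // (le_trans b0).
  - rewrite lef_pV2 ?posrE ?exprn_gt0 // ?(lt_le_trans gn) //.
    by rewrite ler_pXn2r ?nnegrE ?(ltW gn) // (le_trans (ltW gn)).
have -> : 2 * (9 * B ^+ 4 * n%:R) / (g * n%:R) ^+ 2 =
    36 * B ^+ 4 / g ^+ 2 * (2 * n%:R)^-1.
  by field; rewrite !lt0r_neq0.
rewrite ler_wpM2l //.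
  by rewrite mulr_ge0 ?invr_ge0 ?sqr_ge0 // mulr_ge0 // exprn_ge0 // (le_trans b0).
rewrite /harmonic /= lef_pV2 ?posrE ?mulr_gt0 // -natrM ler_nat; lia.
Qed.

Lemma powR_inv_sqrt_le (R : realType) (eps eta : R) : 0 < eps -> 0 < eta ->
  (eps < 1 -> eta = Num.sqrt eps) -> (1 <= eps -> eta = 1) ->
  eps `^ (- 2^-1) <= eta^-1.
Proof.
move=> eps0 eta0 small large; rewrite powRN powR12_sqrt ?(ltW eps0) //.
have [eps1|eps1] := ltP eps 1; first by rewrite small.
rewrite large // lef_pV2 ?posrE ?sqrtr_gt0 //.
by rewrite -sqrtr1 ler_wsqrtr.
Qed.

(* The numerals are hidden behind variables to keep their unary encodings out
   of later unification problems. *)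
Lemma spanner_event_prob_const (R : realType) : exists a b : R,
  [/\ 0 < a, 0 <= b & forall d (T : measurableType d) (P : probability T R) n
    (X : 'I_n -> {RV P >-> (R * R)%type}) (Y : vpair n -> {RV P >-> bool})
    (p : R) (h s : nat) (eta eps thr : R)
    (q0 := s%:R ^+ 2 / (2 * h)%:R ^+ 2)
    (e0 := n%:R * n.-1%:R * (p * (q0 / 4))), random_geometric_model X Y p ->
  (3 * s <= h)%N -> 1 <= s%:R :> R -> 0 < eta -> 1 <= eta * s%:R -> 0 < eps ->
  (eps < 1 -> eta ^+ 2 = eps) -> (1 <= eps -> eta = 1) -> 0 <= p ->
  n%:R * p * (a * eta * q0) <= 2^-1 -> 0 < e0 -> thr <= e0 / 8 ->
  ((1 - 2 * (9 * (4 + n%:R * p * (b * q0)) ^+ 4 * n%:R) / (e0 / 8) ^+ 2)%:E <=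
  P [set w | forall E' : {set {set 'I_n}},
     spanner (1 + eps) (random_edges Y w) (random_len X w) E' ->
     (thr <= #|E'|%:R)%R])%E].
Proof.
exists 2425, 625; split; [by rewrite ltr0n | by rewrite ler0n |].
move=> d T P n X Y p h s eta eps thr q0 e0 model; exact: (spanner_event_prob model).
Qed.

Theorem theorem2 (R : realType) :
  exists c : R, 0 < c /\
  forall (eps : R), 0 < eps ->
  forall (p : nat -> R), (forall n, 0 <= p n <= 1) ->
  (n%:R * p n ^+ 2 @[n --> \oo] --> +oo) ->
  forall (d : nat -> measure_display) (T : forall n, measurableType (d n))
    (P : forall n, probability (T n) R)
    (X : forall n, 'I_n -> {RV (P n) >-> (R * R)%type})
    (Y : forall n, vpair n -> {RV (P n) >-> bool}),
  (forall n, random_geometric_model (X n) (Y n) (p n)) ->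
  P n [set w | forall E' : {set {set 'I_n}},
         spanner (1 + eps) (random_edges (Y n) w) (random_len (X n) w) E' ->
         c * eps `^ (- 2^-1) * n%:R <= #|E'|%:R]
    @[n --> \oo] --> 1%E.
Proof.
have [a [b [a0 b0 event_prob]]] := spanner_event_prob_const R.
have h512 : 0 < 512 :> R by rewrite ltr0n.
have k0 : 0 < 512 * a := mulr_gt0 h512 a0.
(* [512 = 64 * 8]: the 64 comes from [grid_size], the 8 from the threshold [e0 / 8]. *)
exists (512 * a)^-1; split; first by rewrite invr_gt0.
move=> eps eps0 p p01 np2 d T P X Y model.
(* [eta] is the minimum of 1 and the square root of [eps], the relative width of the obstacle
   region. *)
pose eta := if eps < 1 then Num.sqrt eps else 1.
have eta0 : 0 < eta by rewrite /eta; case: ifP => // _; rewrite sqrtr_gt0.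
have eta_small : eps < 1 -> eta = Num.sqrt eps by rewrite /eta => ->.
have eta_large : 1 <= eps -> eta = 1 by rewrite /eta ltNge => ->.
have eta_sq : eps < 1 -> eta ^+ 2 = eps.
  by move=> /eta_small ->; rewrite sqr_sqrtr // ltW.
have eta1 : eta <= 1.
  have [/[dup] eps1 /eta_small ->|/eta_large -> //] := ltP eps 1.
  by rewrite -sqrtr1 ler_wsqrtr // ltW.
(* The scale [s] depends on [eps] only; it makes the strip, of width about [eta * s], at least one
   cell wide. *)
pose s := Num.Def.archi_bound eta^-1.
have s_eta : eta^-1 < s%:R.
  by apply: archi_boundP; rewrite invr_ge0 ltW.
have etas : 1 <= eta * s%:R.
  by rewrite -[leLHS](mulfV (lt0r_neq0 eta0)) ler_wpM2l ?(ltW eta0) ?(ltW s_eta).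
have s1 : 1 <= s%:R :> R.
  by apply: (le_trans etas); rewrite ler_piMl.
have s0 : (0 < s)%N by rewrite -(ler1n R).
have ae : 0 < a * eta by rewrite mulr_gt0.
(* [B] bounds the growth factor uniformly in [n], because the smallness condition gives
   [n * p * q0 <= 1 / (2 * a * eta)]. *)
pose B := 4 + b / (2 * (a * eta)).
pose g := (512 * a * eta)^-1.
have g0 : 0 < g by rewrite invr_gt0 mulr_gt0.
pose lower n : R := 1 - 36 * B ^+ 4 / g ^+ 2 * harmonic n.
apply: (@squeeze_cvge _ _ _ R (fun n => (lower n)%:E) _ (fun=> 1%E)).
- have np_big : \forall n \near \oo, 18 / (a * eta) <= n%:R * p n ^+ 2.
    exact: (proj1 (cvgryPge _) np2).
  near=> n.
  have n2 : (2 <= n)%N by near: n; exact: nbhs_infty_ge.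
  (* Since [p n <= 1], [n * p] is at least [n * p ^ 2], which tends to infinity. *)
  have np : 18 / (a * eta) <= n%:R * p n.
    apply: (@le_trans _ _ (n%:R * p n ^+ 2)); first by near: n.
    by have /andP[p0 p1] := p01 n; rewrite ler_wpM2l // expr2 ler_piMl.
  have [h [sh small big]] := grid_size a0 eta0 n2 s0 np.
  set q0 := _ / _ in small big.
  rewrite probability_le1 ?andbT; last first.
    exact: (measurable_spanner_event (X n) (Y n) (1 + eps) (fun E' => _)).
  have /andP[p0 _] := p01 n.
  have e8 : g * n%:R <= n%:R * n.-1%:R * (p n * (q0 / 4)) / 8.
    have -> : g * n%:R = n%:R / (64 * a * eta) / 8.
      by rewrite /g; field; rewrite !lt0r_neq0.
    by rewrite ler_pM2r.
  have thr : (512 * a)^-1 * eps `^ (- 2^-1) * n%:R <=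
      n%:R * n.-1%:R * (p n * (q0 / 4)) / 8.
    apply: le_trans e8; rewrite ler_wpM2r // /g [leRHS]invfM.
    by rewrite ler_wpM2l ?invr_ge0 ?(ltW k0) // powR_inv_sqrt_le.
  have n0 : 0 < n%:R :> R by rewrite ltr0n (leq_trans _ n2).
  have e0 : 0 < n%:R * n.-1%:R * (p n * (q0 / 4)).
    by rewrite -(pmulr_lgt0 _ (_ : 0 < 8^-1)) // (lt_le_trans _ e8) // mulr_gt0.
  apply: le_trans (event_prob _ _ _ _ _ _ _ _ _ _ _ _ (model n) sh s1 eta0
    etas eps0 eta_sq eta_large p0 small e0 thr).
  rewrite lee_fin lerD2l lerN2; apply: failure_le_harmonic => //.
  + by rewrite addr_ge0 // mulr_ge0 ?mulr_ge0.
  + rewrite -/q0 lerD2l mulrCA ler_wpM2l // -div1r ler_pdivlMr ?mulr_gt0 //.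
    by move: small; lra.
  + by rewrite (leq_trans _ n2).
- rewrite -[1%E]/((1 : R)%:E); apply: cvg_EFin; first exact: nearW.
  rewrite -[X in _ --> X]subr0; apply: cvgB; first exact: cvg_cst.
  rewrite -[X in _ --> X](mulr0 (36 * B ^+ 4 / g ^+ 2)).
  by apply: cvgM; [exact: cvg_cst | exact: cvg_harmonic].
- exact: cvg_cst.
Unshelve. all: by end_near.
Qed.
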